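(* Assume that the functional $E:\Omega\to(-\infty,+\infty]$ is proper, i.e. $N=\inf_{\Omega}E<+\infty$. Then there exists a unique minimum point $\bar\xi^0=(\xi^0_i)_{i\in\mathbb{N}}\in\Omega$ of $E$, i.e. a unique point of $\Omega$ with $E(\bar\xi^0)=N$. Moreover, $\lim_{i\to\infty}\xi^0_i=0$, and the function $u=u(\xi)$, $\xi=x/\sqrt{t}$, defined (with $\xi^0_0=+\infty$) by $$u(\xi)=u_i+\frac{u_{i+1}-u_i}{F(\xi^0_{i+1}/a_i)-F(\xi^0_i/a_i)}\bigl(F(\xi/a_i)-F(\xi^0_i/a_i)\bigr),\qquad \xi^0_{i+1}<\xi<\xi^0_i,\ i=0,1,\ldots,$$ and $u(\xi^0_i)=u_i$ for $i\ge 1$, is a solution of the Stefan–Dirichlet problem with infinitely many phase transitions described in the context.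
   Context: Data: real numbers $u_0\le u_1$ and a strictly increasing sequence $u_1<u_2<u_3<\cdots$; $u_D=\lim_{i\to\infty}u_i\le+\infty$; constants $a_i>0$, $k_i>0$ ($i=0,1,2,\ldots$) and $d_i\ge 0$ ($i=1,2,\ldots$), with $d_1>0$ if $u_1=u_0$. Here $\mathbb{N}=\{1,2,\ldots\}$. Put $F(\xi)=\frac{1}{\sqrt{\pi}}\int_0^\xi e^{-s^2/4}\,ds$, with $F(+\infty)=1$. Let $l_\infty$ be the space of bounded real sequences, $\Omega=\{\bar\xi=(\xi_i)_{i\in\mathbb{N}}\in l_\infty : \xi_i>\xi_{i+1}>0\ \ \forall i\in\mathbb{N}\}$ and, with the convention $\xi_0=+\infty$, $$E(\bar\xi)=-\sum_{i=0}^\infty k_i(u_{i+1}-u_i)\ln\bigl(F(\xi_i/a_i)-F(\xi_{i+1}/a_i)\bigr)+\sum_{i=1}^\infty\frac{d_i\xi_i^2}{4},\qquad\bar\xi\in\Omega.$$ All terms are nonnegative, so $E$ is well defined, possibly with value $+\infty$. Stefan–Dirichlet problem: find a continuous piecewise smooth function $u=u(t,x)$ on $\{t>0,\ x>0\}$ such that $u_t=a_i^2u_{xx}$ (classically) in each domain where $u_i<u<u_{i+1}$, $i=0,1,2,\ldots$; on each phase transition line $x=x_i(t)$ where $u=u_i$, $i=1,2,\ldots$, the Stefan condition $$d_i x_i'(t)+k_iu_x(t,x_i(t)+)-k_{i-1}u_x(t,x_i(t)-)=0$$ holds, where $u_x(t,x_i(t)+)$ and $u_x(t,x_i(t)-)$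 are the one-sided limits on the line taken from the warmer phase (phase $i$) and from the colder phase (phase $i-1$), respectively; and $u(0,x)=u_0$ for all $x>0$, $u(t,0)=u_D$ for all $t>0$. For a self-similar function $u=u(\xi)$, $\xi=x/\sqrt t$, the phase transition lines are $x=\xi_i\sqrt t$ and the initial and boundary conditions mean $\lim_{\xi\to+\infty}u(\xi)=u_0$ and $\lim_{\xi\to 0+}u(\xi)=u_D$ (possibly $+\infty$). If $u_0=u_1$, then $u\equiv u_0$ for $\xi>\xi_1$ and the derivative from the colder side at $\xi_1$ is $0$. *)

(* Defs.v *)
From HB Require Import structures.
From mathcomp Require Import all_boot all_order all_algebra.
From mathcomp Require Import all_classical all_reals all_analysis.

Set Implicit Arguments.
Unset Strict Implicit.
Unset Printing Implicit Defensive.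

Import Order.TTheory GRing.Theory Num.Theory.
Import numFieldNormedType.Exports.

Local Open Scope classical_set_scope.
Local Open Scope ring_scope.

(* Indexing.  The data u, a, k are indexed by i = 0, 1, 2, ... and d by
   i = 1, 2, ... (the value d 0 is never used).  A sequence (xi_i) with
   i = 1, 2, ... is a function xi : nat -> R with xi j standing for xi_{j+1},
   so that equality of functions is equality of sequences. *)

(* The value at +oo is the limit of F; F is only used on ]0, +oo]. *)
Definition F {R : realType} (z : \bar R) : R :=
  match z with
  | r%:E => (Num.sqrt pi)^-1 *
      \int[lebesgue_measure]_(s in `[0, r]) expR (- (s ^+ 2 / 4))
  | +oo%E => 1
  | -oo%E => - 1
  end.

(* xi_i for i = 0, 1, 2, ... with the convention xi_0 = +oo. *)
Definition ext {R : realType} (xi : nat -> R) (i : nat) : \bar R :=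
  if i is j.+1 then (xi j)%:E else +oo%E.

(* F(xi_i / a_l) *)
Definition Fdiv {R : realType} (a xi : nat -> R) (l i : nat) : R :=
  F (ext xi i * ((a l)^-1)%:E)%E.

Definition Omega {R : realType} : set (nat -> R) :=
  [set xi : nat -> R | bounded_fun (xi : nat -> R^o) /\ forall j, 0 < xi j.+1 < xi j].

Definition E {R : realType} (u a k d : nat -> R) (xi : nat -> R) : \bar R :=
  (\sum_(0 <= i <oo)
      (- (k i * (u i.+1 - u i) * ln (Fdiv a xi i i - Fdiv a xi i i.+1)))%:E
   + \sum_(0 <= j <oo) (d j.+1 * xi j ^+ 2 / 4)%:E)%E.

Definition is_profile {R : realType} (u a xi : nat -> R) (U : R -> R) : Prop :=
  (forall i z, (ext xi i.+1 < z%:E < ext xi i)%E ->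
     U z = u i + (u i.+1 - u i) / (Fdiv a xi i i.+1 - Fdiv a xi i i)
                 * (F (z / a i)%:E - Fdiv a xi i i))
  /\ (forall j, U (xi j) = u j.+1).

(* Functions of (t, x). *)

Definition quadrant {R : realType} : set (R * R) :=
  [set p | 0 < p.1 /\ 0 < p.2].

Definition partial_t {R : realType} (v : R -> R -> R) : R -> R -> R :=
  fun t x => derive1 (v ^~ x) t.

Definition partial_x {R : realType} (v : R -> R -> R) : R -> R -> R :=
  fun t x => derive1 (v t) x.

Definition continuous_on_quadrant {R : realType} (v : R -> R -> R) : Prop :=
  forall p : R * R, quadrant p ->
    {for p, continuous (fun q : R * R => v q.1 q.2)}.

(* Class C^n on the (open) quadrant. *)
Fixpoint Cn {R : realType} (n : nat) (v : R -> R -> R) : Prop :=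
  continuous_on_quadrant v /\
  if n is m.+1 then
    [/\ forall t x, quadrant (t, x) ->
          derivable (v ^~ x) t 1 /\ derivable (v t) x 1,
        Cn m (partial_t v) & Cn m (partial_x v)]
  else True.

Definition smooth {R : realType} (v : R -> R -> R) : Prop :=
  forall n, Cn n v.

(* The part of the quadrant between the curves x = x_{i+1}(t) and
   x = x_i(t), where x_0 = +oo. *)
Definition strip {R : realType} (s : nat -> R -> R) (i : nat) : set (R * R) :=
  [set p | quadrant p /\
     (ext (s ^~ p.1) i.+1 < (p.2)%:E < ext (s ^~ p.1) i)%E].

Definition phase {R : realType} (u : nat -> R) (v : R -> R -> R) (i : nat) :
    set (R * R) :=
  [set p | quadrant p /\ u i < v p.1 p.2 < u i.+1].

(* v = v(t, x) solves the Stefan-Dirichlet problem, with phase transition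
   lines x = x_i(t), i = 1, 2, ..., where s j is x_{j+1}.
   - The domain u_i < v < u_{i+1} is the strip between two consecutive lines.
     If u_0 = u_1, this domain is empty for i = 0, and v = u_0 beyond the first
     line; the derivative from the colder side is then 0 on that line.
   - Piecewise smooth: the lines are smooth and on each strip v is the
     restriction of a smooth function of the quadrant, i.e., v is smooth up to
     the lines.
   - The warmer phase lies to the left of each line: the one-sided
     derivative denoted by "+" in the Stefan condition is a left limit in x.
   - The initial and boundary values are one-sided limits, the latter in the
     extended reals because u_D may be +oo.  *)
Record stefan_dirichlet_solution {R : realType} (u a k d : nat -> R)
    (s : nat -> R -> R) (v : R -> R -> R) : Prop := StefanDirichletSolution {
  sd_lines_ordered : forall j (t : R), 0 < t -> 0 < s j.+1 t < s j t ;
  sd_lines_smooth : forall j, smooth (fun t _ : R => s j t) ;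
  sd_cover : forall t x, quadrant (t, x) ->
    (exists i, strip s i (t, x)) \/ (exists j, x = s j t) ;
  sd_phase : forall i, u i < u i.+1 -> phase u v i = strip s i ;
  sd_no_phase0 : u 0%N = u 1%N ->
    forall t x, strip s 0 (t, x) -> v t x = u 0%N ;
  sd_line : forall j (t : R), 0 < t -> v t (s j t) = u j.+1 ;
  sd_continuous : continuous_on_quadrant v ;
  sd_piecewise_smooth : forall i, exists2 w : R -> R -> R,
    smooth w & forall t x, strip s i (t, x) -> v t x = w t x ;
  sd_heat : forall i t x, phase u v i (t, x) ->
    partial_t v t x = a i ^+ 2 * partial_x (partial_x v) t x ;
  sd_stefan : forall j (t : R), 0 < t -> exists warm cold : R,
    [/\ partial_x v t y @[y --> (s j t)^'-] --> warm,
        partial_x v t y @[y --> (s j t)^'+] --> cold &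
        d j.+1 * derive1 (s j) t + k j.+1 * warm - k j * cold = 0] ;
  sd_initial : forall x : R, 0 < x -> v t x @[t --> 0^'+] --> u 0%N ;
  sd_boundary : forall t : R, 0 < t ->
    (v t x)%:E @[x --> 0^'+] --> limn (fun i => (u i)%:E)
}.

(* Main.v *)
Require Import Defs.
From HB Require Import structures.
From mathcomp Require Import all_boot all_order all_algebra.
From mathcomp Require Import ring lra.
From mathcomp Require Import all_classical all_reals all_analysis.
Import Order.TTheory GRing.Theory Num.Theory.
Import numFieldNormedType.Exports.
Local Open Scope classical_set_scope.
Local Open Scope ring_scope.

(** The functional is a sum of convex terms.  Up to a positive factor, the
    i-th logarithmic term is minus the logarithm of F x - F y, the Gaussian
    mass of the interval between y = xi_{i+1} / a_i and x = xi_i / a_i, and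
    this mass is a strictly log-concave function of the two endpoints
    ([ln_F_hessian_lt0], [ln_F_strictly_concave]; for i = 0 the right endpoint
    is +oo and concavity follows by a limit, [ln_1F_concave]).  Each
    xi_i with i >= 1 is the right endpoint in the i-th term, whose weight is
    positive, so the midpoint of two distinct minimizers would have a smaller
    energy: the minimizer is unique.

    It exists by compactness.  All terms are nonnegative, hence E xi <= c means
    that every partial sum is at most c ([E_le]), and partial sums are
    continuous for pointwise convergence.  A bound on E bounds the first
    coordinate, from above, through the first phase if u_0 < u_1 and through
    d_1 otherwise ([first_coordinate_bound]), so a minimizing sequence stays in
    a cube [0, M]^nat and clusters somewhere by Tychonoff's theorem.  A bound
    on E also keeps each Gaussian mass with positive weight away from 0
    ([gap_lower_bound]), so the strict inequalities which define Omega survive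
    in the limit ([minimizer_exists]).

    At the minimizer the coordinates tend to 0: if their limit L were positive,
    then subtracting L from all of them would stay in Omega, decrease all
    squares, and increase all Gaussian masses because the density decreases on
    the half-line ([F_shift_lt], [minimizer_cvg0]).  Moving a single coordinate
    only changes two logarithms and one square, and the vanishing of the
    corresponding derivative is the Stefan condition
    ([minimizer_stationary], [stefan_condition]).

    The other requirements of the Stefan-Dirichlet problem concern the explicit
    profile.  Inside a layer the solution is A + B F (x / (a sqrt t)), whose
    partial derivatives of all orders stay in one algebra of functions with
    explicit generators; there, smoothness and the heat equation are symbolic
    computations ([smooth_heval], [similarity_heat]).  Across layers one uses
    that u increases and that the layers are the intervals cut out by a
    sequence decreasing to 0, so that they cover the half-line. *)

(** * The normalized error function *)

(** The density of F: on the half-line, twice that of a centred Gaussian variable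
    of variance 2. *)
Definition dF {R : realType} (x : R) : R :=
  (Num.sqrt pi)^-1 * expR (- (x ^+ 2 / 4)).

Lemma dF_gt0 {R : realType} (x : R) : 0 < dF x.
Proof. by rewrite mulr_gt0 ?expR_gt0// invr_gt0 sqrtr_gt0 pi_gt0. Qed.

Lemma is_derive_dF {R : realType} (x : R) :
  is_derive x 1 (@dF R) (- (x / 2) * dF x).
Proof.
rewrite /dF; apply: is_derive_eq.
rewrite /GRing.scale/= !mulr0 add0r; field.
by rewrite gt_eqF// sqrtr_gt0 pi_gt0.
Qed.

Lemma F0 {R : realType} : F (0 : R)%:E = 0.
Proof. by rewrite /F set_itv1 Rintegral_set1 mulr0. Qed.

Lemma integrable_gauss {R : realType} (r : R) :
  (@lebesgue_measure R).-integrable `[0, r]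
    (EFin \o (fun s : R => expR (- (s ^+ 2 / 4)))).
Proof.
apply: continuous_compact_integrable; first exact: segment_compact.
apply: continuous_subspaceT => x.
apply: (@differentiable_continuous _ R^o R^o).
exact/derivable1_diffP.
Qed.

Lemma is_derive_F {R : realType} (x : R) : 0 < x ->
  is_derive x 1 (fun z => F z%:E) (dF x).
Proof.
move=> x0.
have [dI I'] : derivable (fun z : R => \int[lebesgue_measure]_(s in `[0, z])
                 expR (- (s ^+ 2 / 4))) x 1 /\
      derive1 (fun z : R => \int[lebesgue_measure]_(s in `[0, z])
                 expR (- (s ^+ 2 / 4))) x = expR (- (x ^+ 2 / 4)).
  apply: (@continuous_FTC1_closed _ _ 0 x (x + 1)) => //.
  - by rewrite ltrDl.
  - exact: integrable_gauss.
  apply: (@differentiable_continuous _ R^o R^o).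
  exact/derivable1_diffP.
rewrite derive1E in I'.
have dI' := DeriveDef dI I'.
rewrite /F; apply: is_derive_eq.
by rewrite /dF /GRing.scale/=.
Qed.

Lemma continuous_F {R : realType} (x : R) :
  {within `[0, x], continuous (fun z => F z%:E)}.
Proof.
have [x0|x0] := ltP x 0.
  by rewrite set_itv_ge ?bnd_simp -?ltNge//; exact: continuous_subspace0.
move=> z; rewrite /F; apply: cvgM; first exact: cvg_cst.
apply: parameterized_integral_continuous => //.
exact: integrable_gauss.
Qed.

Lemma F_lt {R : realType} (x y : R) : 0 <= x -> x < y -> F x%:E < F y%:E.
Proof.
move=> x0 xy.
have [|||c] := @MVT R (fun z => F z%:E) dF x y.
- by [].
- move=> z /[!in_itv]/= /andP[xz zy].
  by apply: is_derive_F; exact: le_lt_trans xz.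
- apply: continuous_subspaceW (continuous_F y).
  by apply: subset_itv; rewrite bnd_simp.
move=> _ Fxy; rewrite -subr_gt0 Fxy mulr_gt0 ?dF_gt0// subr_gt0//.
Qed.

Lemma F_le {R : realType} (x y : R) : 0 <= x -> x <= y -> F x%:E <= F y%:E.
Proof. by move=> x0; rewrite le_eqVlt => /orP[/eqP->//|xy]; exact/ltW/F_lt. Qed.

Lemma F_ge0 {R : realType} (x : R) : 0 <= x -> 0 <= F x%:E.
Proof. by move=> x0; rewrite -[leLHS]F0 F_le. Qed.

Lemma F_lipschitz {R : realType} (x y : R) : 0 <= y -> y < x ->
  F x%:E - F y%:E <= (Num.sqrt pi)^-1 * (x - y).
Proof.
move=> y0 yx; have [|||c] := @MVT R (fun z => F z%:E) dF y x.
- by [].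
- move=> z /[!in_itv]/= /andP[yz _].
  by apply: is_derive_F; exact: le_lt_trans yz.
- apply: continuous_subspaceW (continuous_F x).
  by apply: subset_itv; rewrite bnd_simp.
move=> _ ->; rewrite ler_pM2r ?subr_gt0// /dF ler_piMr//.
by rewrite -[leRHS]expR0 ler_expR oppr_le0 divr_ge0// sqr_ge0.
Qed.

(** Both sides have the same derivative on the open half-line, so their
    difference is constant there; it is 0 because both sides are bounded by a
    multiple of x near 0.  (Being 0 at negative arguments, F has no two-sided
    derivative at 0.) *)
Lemma F_integral0_gauss {R : realType} (x : R) : 0 < x ->
  F x%:E = 2 / Num.sqrt pi * gauss_integral_proof.integral0_gauss (x / 2).
Proof.
move=> x0; set G := gauss_integral_proof.integral0_gauss.
have iG (r : R) : (@lebesgue_measure R).-integrable `[0, r]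
    (EFin \o (@gauss_fun R)).
  apply: continuous_compact_integrable; first exact: segment_compact.
  by apply: continuous_subspaceT => ?; exact: continuous_gauss_fun.
have dG (z : R) : 0 < z -> is_derive z 1 G (gauss_fun z).
  move=> z0.
  have [dI I'] : derivable G z 1 /\ derive1 G z = gauss_fun z.
    apply: (@continuous_FTC1_closed _ _ 0 z (z + 1)) => //.
    - by rewrite ltrDl.
    - exact: continuous_gauss_fun.
  by rewrite derive1E in I'; exact: (DeriveDef dI I').
pose h z : R := F z%:E - 2 / Num.sqrt pi * G (z / 2).
have dh (z : R) : 0 < z -> is_derive z 1 h 0.
  move=> z0.
  have dm : is_derive z 1 (fun y : R => y / 2) (2^-1).
    by apply: is_derive_eq; rewrite /GRing.scale/= ?mulr0 ?addr0 ?add0r ?mulr1.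
  have z20 : 0 < z / 2 by rewrite divr_gt0.
  have dGz := dG _ z20.
  have dG2 := @is_derive1_comp _ G (fun y : R => y / 2) _ _ _ dGz dm.
  have := is_derive_F _ z0 => dFz.
  rewrite /h; apply: is_derive_eq.
  rewrite /GRing.scale/= ?mulr0 ?addr0 ?add0r /dF /gauss_fun.
  have -> : (z / 2) ^+ 2 = z ^+ 2 / 4 by field.
  by field; rewrite gt_eqF// sqrtr_gt0 pi_gt0.
have hx (y : R) : 0 < y -> y < x -> h y = h x.
  move=> y0 yx; have [|||c] := @MVT R h (cst 0) y x.
  - by [].
  - by move=> z /[!in_itv]/= /andP[yz _]; exact/dh/(lt_trans y0).
  - apply: derivable_within_continuous => z /[!in_itv]/= /andP[yz _].
    by have [] := dh z (lt_le_trans y0 yz).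
  by rewrite /cst mul0r => _ /eqP; rewrite subr_eq0 => /eqP.
have sp : 0 < (Num.sqrt pi)^-1 :> R by rewrite invr_gt0 sqrtr_gt0 pi_gt0.
have Fb (y : R) : 0 < y -> F y%:E <= (Num.sqrt pi)^-1 * y.
  by move=> y0; have := F_lipschitz y 0 (lexx 0) y0; rewrite F0 !subr0.
have Gb (y : R) : 0 < y -> G y <= y.
  move=> y0; have [|||c] := @MVT R G (@gauss_fun R) 0 y.
  - by [].
  - by move=> z /[!in_itv]/= /andP[z0 _]; exact: dG.
  - by apply: parameterized_integral_continuous => //; exact: ltW.
  rewrite /G /gauss_integral_proof.integral0_gauss set_itv1 Rintegral_set1 !subr0.
  by move=> _ ->; rewrite ler_piMl//; [exact: ltW|exact: gauss_fun_le1].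
have hb (y : R) : 0 < y -> `|h y| <= (Num.sqrt pi)^-1 * y.
  move=> y0; have y20 : 0 < y / 2 by rewrite divr_gt0.
  have := Fb _ y0; have := F_ge0 _ (ltW y0).
  have : 0 <= 2 / Num.sqrt pi * G (y / 2).
    rewrite mulr_ge0 ?divr_ge0 ?sqrtr_ge0//.
    exact: gauss_integral_proof.integral0_gauss_ge0.
  have : 2 / Num.sqrt pi * G (y / 2) <= (Num.sqrt pi)^-1 * y.
    rewrite mulrAC -[leRHS]mulrC ler_pM2r// mulrC -ler_pdivlMr//.
    exact: Gb.
  by rewrite ler_norml /h; lra.
suff : h x = 0 by move/eqP; rewrite subr_eq0 => /eqP.
apply/eqP; rewrite -normr_eq0; apply/negPn/negP => hx0.
have {}hx0 : 0 < `|h x| by rewrite lt_neqAle eq_sym hx0 normr_ge0.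
pose y := Num.min (x / 2) (Num.sqrt pi * `|h x| / 2).
have y0 : 0 < y.
  rewrite /y lt_min !divr_gt0//= mulr_gt0 ?sqrtr_gt0 ?pi_gt0//.
have yx : y < x.
  by rewrite /y gt_min; apply/orP; left; lra.
have := hb _ y0; rewrite (hx _ y0 yx) leNgt => /negP; apply.
rewrite ltr_pdivrMl ?sqrtr_gt0 ?pi_gt0//.
rewrite /y gt_min; apply/orP; right.
by rewrite ltr_pdivrMr// ltr_pMr ?mulr_gt0 ?sqrtr_gt0 ?pi_gt0// ltr1n.
Qed.

Lemma cvg_F {R : realType} : F (x : R)%:E @[x --> +oo] --> (1 : R).
Proof.
have spi : Num.sqrt (pi : R) != 0 by rewrite gt_eqF// sqrtr_gt0 pi_gt0.
have cG : @gauss_integral_proof.integral0_gauss R x @[x --> +oo]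
    --> Num.sqrt pi / 2.
  have -> : Num.sqrt pi / 2 = Num.sqrt (pi / 4) :> R.
    rewrite sqrtrM ?pi_ge0// sqrtrV// (_ : 4 = 2 ^+ 2); last first.
      by rewrite expr2 -natrM.
    by rewrite sqrtr_sqr ger0_norm.
  rewrite (_ : gauss_integral_proof.integral0_gauss =
     fun x => Num.sqrt (gauss_integral_proof.integral0_gauss x ^+ 2)); last first.
    apply/funext => x; rewrite sqrtr_sqr ger0_norm//.
    exact: gauss_integral_proof.integral0_gauss_ge0.
  apply: continuous_cvg; first exact: sqrt_continuous.
  exact: gauss_integral_proof.cvg_integral0_gauss_sqr.
have -> : 1 = 2 / Num.sqrt pi * (Num.sqrt pi / 2) :> R by field.
have : (fun x : R => 2 / Num.sqrt pi *
    gauss_integral_proof.integral0_gauss (x / 2)) @ +oo -->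
    2 / Num.sqrt pi * (Num.sqrt pi / 2).
  apply: cvgM; first exact: cvg_cst.
  apply: (@cvg_comp _ _ _ (fun x : R => x / 2)
    gauss_integral_proof.integral0_gauss _ +oo) => //.
  apply: gt0_cvgMly => //; exact: cvg_id.
apply: cvg_trans; apply: near_eq_cvg; near=> x.
by rewrite F_integral0_gauss.
Unshelve. all: by end_near. Qed.

Lemma F_lt1 {R : realType} (x : R) : 0 <= x -> F x%:E < 1.
Proof.
move=> x0; have lt1 : F x%:E < F (x + 1)%:E by rewrite F_lt// ltrDl.
apply: lt_le_trans lt1 _.
rewrite -[leRHS](cvg_lim _ (@cvg_F R))//.
apply: limr_ge.
  by apply/cvg_ex; exists 1; exact: cvg_F.
near=> y; apply: F_le; first by rewrite addr_ge0.
by near: y; apply: nbhs_pinfty_ge; rewrite num_real.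
Unshelve. all: by end_near. Qed.

Lemma is_derive1_inv {R : realType} (f : R -> R) (x df : R) : f x != 0 ->
  is_derive x 1 f df -> is_derive x 1 (fun y => (f y)^-1) (- (f x) ^- 2 * df).
Proof.
move=> fx0 [dfx <-].
by apply: DeriveDef; [exact: derivableV|exact: deriveV].
Qed.

(** * Log-concavity of the Gaussian mass of an interval *)

Lemma midpoint_strictly_concave {R : realType} (L L1 L2 : R -> R) :
  (forall t : R, 0 <= t <= 1 -> is_derive t 1 L (L1 t)) ->
  (forall t : R, 0 <= t <= 1 -> is_derive t 1 L1 (L2 t)) ->
  (forall t : R, 0 <= t <= 1 -> L2 t < 0) ->
  L 0 + L 1 < 2 * L 2^-1.
Proof.
move=> dL dL1 L2_lt0.
have mvt (f f' : R -> R) (s t : R) : (forall t : R, 0 <= t <= 1 -> is_derive t 1 f (f' t)) ->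
    0 <= s -> s < t -> t <= 1 ->
    exists2 c, s < c < t & f t - f s = f' c * (t - s).
  move=> df s0 st t1; have [|||c] := @MVT R f f' s t.
  - by [].
  - by move=> z /[!in_itv]/= ?; apply: df; lra.
  - apply: derivable_within_continuous => z /[!in_itv]/= ?.
    by have [] : is_derive z 1 f (f' z) by apply: df; lra.
  by rewrite in_itv/= => cst fE; exists c.
have [|||c c0 E1] := mvt _ _ 0 2^-1 dL; try lra.
have [|||e e0 E2] := mvt _ _ 2^-1 1 dL; try lra.
have [|||b b0 E3] := mvt _ _ c e dL1; try lra.
have : L2 b * (e - c) < 0 by rewrite nmulr_rlt0 ?L2_lt0; lra.
lra.
Qed.

(** The derivative of dF s / s + F s / 2 is - dF s / s ^ 2, as the two terms in
    dF s cancel.  This comparison is exactly what makes the determinant of the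
    Hessian of ln (F x - F y) positive. *)
Lemma dF_ratio_lt {R : realType} (x y : R) : 0 < y -> y < x ->
  dF x / x + F x%:E / 2 < dF y / y + F y%:E / 2.
Proof.
move=> y0 yx; pose h (s : R) := dF s / s + F s%:E / 2.
have dh (s : R) : 0 < s -> is_derive s 1 h (- (dF s / s ^+ 2)).
  move=> s0; have sN0 : s != 0 by rewrite gt_eqF.
  have d1 := is_derive_dF s; have d2 := is_derive_F _ s0.
  have d3 : is_derive s 1 (fun s : R => s^-1) (- s ^- 2).
    apply: is_derive_eq; first exact: (@is_derive1_inv _ id _ _ sN0).
    by rewrite mulr1.
  have d4 := is_deriveM d1 d3.
  rewrite /h; apply: is_derive_eq.
  by rewrite /GRing.scale/= !mulr0 add0r; field.
have [|||c] := @MVT R h (fun s => - (dF s / s ^+ 2)) y x.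
- by [].
- by move=> z /[!in_itv]/= ?; apply: dh; lra.
- apply: derivable_within_continuous => z /[!in_itv]/= ?.
  by have [] : is_derive z 1 h (- (dF z / z ^+ 2)) by apply: dh; lra.
rewrite in_itv/= => /andP[yc cx] hE.
have : - (dF c / c ^+ 2) * (x - y) < 0.
  rewrite mulNr oppr_lt0 mulr_gt0 ?subr_gt0// divr_gt0 ?dF_gt0// exprn_gt0//.
  exact: lt_trans yc.
by rewrite -hE subr_lt0.
Qed.

(** With I = F x - F y, this says I * I'' < I' ^ 2 for the derivatives of I in
    the direction (p, q), that is, the second derivative of ln I in that
    direction is negative.  The difference of the two sides is the quadratic
    form A p^2 - 2 f g p q + B q^2 with f = dF x, g = dF y,
    A = f^2 + x f I / 2 and B = g^2 - y g I / 2.  It is positive definite since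
    A > 0 and, by [dF_ratio_lt], A B > (f g)^2. *)
Lemma ln_F_hessian_lt0 {R : realType} (x y p q : R) : 0 < y -> y < x ->
  (p, q) != (0, 0) ->
  (- (p ^+ 2 * (x / 2) * dF x) + q ^+ 2 * (y / 2) * dF y) * (F x%:E - F y%:E)
    < (p * dF x - q * dF y) ^+ 2.
Proof.
move=> y0 yx pq; have x0 := lt_trans y0 yx.
have := F_lt _ _ (ltW y0) yx; rewrite -subr_gt0.
have := dF_ratio_lt x y y0 yx.
have := dF_gt0 x; have := dF_gt0 y.
move: (dF x) (dF y) (F x%:E) (F y%:E) => f g Fx Fy g0 f0 key I0.
pose I := Fx - Fy.
have {key} key : 0 < x * g - y * f - x * y * I / 2.
  have : 0 < (x * y) * (g / y + Fy / 2 - (f / x + Fx / 2)).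
    by rewrite mulr_gt0 ?mulr_gt0 ?subr_gt0.
  congr (_ < _); rewrite /I; field.
  by rewrite !gt_eqF.
rewrite -/I in I0 *.
pose A := f ^+ 2 + x * f * I / 2.
pose B := g ^+ 2 - y * g * I / 2.
have A0 : 0 < A by rewrite addr_gt0 ?exprn_gt0// !mulr_gt0.
have D0 : 0 < A * B - (f * g) ^+ 2.
  have -> : A * B - (f * g) ^+ 2 = f * g * (I / 2) * (x * g - y * f - x * y * I / 2).
    by rewrite /A /B; field.
  by rewrite !mulr_gt0.
(* complete the square in p, after multiplication by A *)
have Q0 : 0 < (A * p - f * g * q) ^+ 2 + q ^+ 2 * (A * B - (f * g) ^+ 2).
  have [q0|q0] := eqVneq q 0.
    have p0 : p != 0 by apply: contra_neq pq => ->; rewrite q0.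
    rewrite q0 mulr0 subr0 expr0n mul0r addr0 exprn_even_gt0//=.
    by rewrite mulf_neq0// gt_eqF.
  by rewrite ltr_wpDl ?sqr_ge0// mulr_gt0// exprn_even_gt0.
rewrite -subr_gt0 -(pmulr_rgt0 _ A0).
by move: Q0; congr (_ < _); rewrite /A /B; field.
Qed.

(** The Hessian inequality is applied along the segment between the two pairs of
    endpoints. *)
Lemma ln_F_strictly_concave {R : realType} (x y x' y' : R) :
  0 < y -> y < x -> 0 < y' -> y' < x' -> (x, y) != (x', y') ->
  ln (F x%:E - F y%:E) + ln (F x'%:E - F y'%:E) <
  2 * ln (F ((x + x') / 2)%:E - F ((y + y') / 2)%:E).
Proof.
move=> y0 yx y'0 y'x' neq.
pose p := x' - x; pose q := y' - y.
pose X (t : R) := x + t * p; pose Y (t : R) := y + t * q.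
have X0 (t : R) : 0 <= t <= 1 -> 0 < Y t < X t.
  move=> /andP[t0 t1].
  have conv (a b : R) : 0 < a -> 0 < b -> 0 < a + t * (b - a).
    move=> a0 b0; have -> : a + t * (b - a) = (1 - t) * a + t * b by ring.
    have [t2|t2] := lerP t 2^-1.
      by rewrite ltr_pwDl ?mulr_ge0 ?mulr_gt0//; lra.
    by rewrite ltr_wpDl ?mulr_ge0 ?mulr_gt0//; lra.
  rewrite conv//= -subr_gt0 (_ : X t - Y t = (x - y) + t * ((x' - y') - (x - y))).
    by rewrite conv// subr_gt0.
  by rewrite /X /Y /p /q; ring.
pose I (t : R) := F (X t)%:E - F (Y t)%:E.
have I0 (t : R) : 0 <= t <= 1 -> 0 < I t.
  by move=> /X0 /andP[? ?]; rewrite subr_gt0 F_lt// ltW.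
pose I1 (t : R) := p * dF (X t) - q * dF (Y t).
pose I2 (t : R) := - (p ^+ 2 * (X t / 2) * dF (X t)) + q ^+ 2 * (Y t / 2) * dF (Y t).
have dX (t : R) : is_derive t 1 X p.
  by rewrite /X; apply: is_derive_eq; rewrite /GRing.scale/=; ring.
have dY (t : R) : is_derive t 1 Y q.
  by rewrite /Y; apply: is_derive_eq; rewrite /GRing.scale/=; ring.
have dI (t : R) : 0 <= t <= 1 -> is_derive t 1 I (I1 t).
  move=> /X0 /andP[Y0 YX]; have XX0 := lt_trans Y0 YX.
  have dFX : is_derive t 1 (fun t => F (X t)%:E) (dF (X t) * p).
    have := is_derive_F _ XX0 => ?; exact: (@is_derive1_comp _ (fun z => F z%:E)).
  have dFY : is_derive t 1 (fun t => F (Y t)%:E) (dF (Y t) * q).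
    have := is_derive_F _ Y0 => ?; exact: (@is_derive1_comp _ (fun z => F z%:E)).
  by rewrite /I; apply: is_derive_eq; rewrite /I1; ring.
have dI1 (t : R) : is_derive t 1 I1 (I2 t).
  have dFX : is_derive t 1 (fun t => dF (X t)) (- (X t / 2) * dF (X t) * p).
    have := is_derive_dF (X t) => ?; exact: (@is_derive1_comp _ dF).
  have dFY : is_derive t 1 (fun t => dF (Y t)) (- (Y t / 2) * dF (Y t) * q).
    have := is_derive_dF (Y t) => ?; exact: (@is_derive1_comp _ dF).
  by rewrite /I1; apply: is_derive_eq; rewrite /I2 /GRing.scale/=; field.
suff : ln (I 0) + ln (I 1) < 2 * ln (I 2^-1).
  have eI (t a b : R) : X t = a -> Y t = b -> I t = F a%:E - F b%:E.
    by rewrite /I => -> ->.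
  rewrite (eI 0 x y) ?(eI 1 x' y')// ?(eI 2^-1 ((x + x') / 2) ((y + y') / 2))//;
    by rewrite /X /Y /p /q; field.
apply: (@midpoint_strictly_concave R (fun t => ln (I t)) (fun t => I1 t / I t)
  (fun t => (I2 t * I t - I1 t ^+ 2) / I t ^+ 2)).
- move=> t t01; have I0t := I0 _ t01; have dIt := dI _ t01.
  have := is_derive1_ln I0t => dln.
  apply: is_derive_eq.
  by rewrite mulrC.
- move=> t t01; have I0t := I0 _ t01; have dIt := dI _ t01.
  have IN0 : I t != 0 by rewrite gt_eqF.
  have dV : is_derive t 1 (fun t => (I t)^-1) (- (I t) ^- 2 * I1 t).
    exact: is_derive1_inv.
  apply: is_derive_eq.
  by rewrite /GRing.scale/= -/(I t); field.
- move=> t t01; have I0t := I0 _ t01.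
  rewrite -/(I t) pmulr_llt0 ?invr_gt0 ?exprn_gt0// subr_lt0.
  have /andP[Y0 YX] := X0 _ t01.
  apply: ln_F_hessian_lt0 => //.
  by apply: contra_neq neq => -[p0 q0]; congr pair; move: p0 q0; rewrite /p /q; lra.
Qed.

Lemma ln_F_concave {R : realType} (x y x' y' : R) :
  0 < y -> y < x -> 0 < y' -> y' < x' ->
  ln (F x%:E - F y%:E) + ln (F x'%:E - F y'%:E) <=
  2 * ln (F ((x + x') / 2)%:E - F ((y + y') / 2)%:E).
Proof.
move=> y0 yx y'0 y'x'.
have [[<- <-]|neq] := eqVneq (x, y) (x', y').
  have half (z : R) : (z + z) / 2 = z by field.
  by rewrite !half mulr_natl mulr2n.
exact/ltW/ln_F_strictly_concave.
Qed.

(** The limit of [ln_F_concave] when both right endpoints equal x and x tends to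
    +oo; strictness is lost. *)
Lemma ln_1F_concave {R : realType} (y y' : R) : 0 < y -> 0 < y' ->
  ln (1 - F y%:E) + ln (1 - F y'%:E) <= 2 * ln (1 - F ((y + y') / 2)%:E).
Proof.
move=> y0 y'0.
have c (z : R) : 0 < z -> ln (F x%:E - F z%:E) @[x --> +oo] --> ln (1 - F z%:E).
  move=> z0.
  have cI : F (x : R)%:E - F z%:E @[x --> +oo] --> 1 - F z%:E.
    by apply: cvgB; [exact: cvg_F|exact: cvg_cst].
  have I0 : 0 < 1 - F z%:E by rewrite subr_gt0 F_lt1// ltW.
  exact: (cvg_comp _ _ cI (continuous_ln I0)).
have c1 := cvgD (c _ y0) (c _ y'0).
have ym0 : 0 < (y + y') / 2 by lra.
have c2 := cvgD (c _ ym0) (c _ ym0).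
rewrite mulr_natl mulr2n; apply: (ler_cvg_to (c1 _) (c2 _)); near=> x.
have yx : y < x by near: x; apply: nbhs_pinfty_gt; rewrite num_real.
have y'x : y' < x by near: x; apply: nbhs_pinfty_gt; rewrite num_real.
have := @ln_F_concave R x y x y' y0 yx y'0 y'x.
have -> : (x + x) / 2 = x by field.
by rewrite mulr_natl mulr2n.
Unshelve. all: by end_near. Qed.

(** Moving an interval of the half-line towards 0 increases its Gaussian mass,
    because the density is decreasing there. *)
Lemma F_shift_lt {R : realType} (x y c l : R) : 0 < l -> 0 < c -> c < y -> y < x ->
  F (x / l)%:E - F (y / l)%:E < F ((x - c) / l)%:E - F ((y - c) / l)%:E.
Proof.
move=> l0 c0 cy yx; pose h (s : R) := F (s / l)%:E - F ((s - c) / l)%:E.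
suff : h x < h y.
  rewrite /h; move: (F _) (F _) (F _) (F _) => A B C D; lra.
have dh (s : R) : c < s -> is_derive s 1 h ((dF (s / l) - dF ((s - c) / l)) / l).
  move=> cs; have s0 : 0 < s / l by rewrite divr_gt0// (lt_trans c0).
  have sc0 : 0 < (s - c) / l by rewrite divr_gt0// subr_gt0.
  have dv (b : R) : is_derive s 1 (fun s : R => (s - b) / l) l^-1.
    by apply: is_derive_eq; rewrite /GRing.scale/=; ring.
  have d1 : is_derive s 1 (fun s => F (s / l)%:E) (dF (s / l) / l).
    have d0 := is_derive_F _ s0; have := dv 0; under eq_fun do rewrite subr0.
    by move=> dv0; exact: (@is_derive1_comp _ (fun z => F z%:E)).
  have d2 : is_derive s 1 (fun s => F ((s - c) / l)%:E) (dF ((s - c) / l) / l).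
    have d0 := is_derive_F _ sc0; have dvc := dv c.
    exact: (@is_derive1_comp _ (fun z => F z%:E)).
  by rewrite mulrBl; exact: (is_deriveB d1 d2).
have [|||z] := @MVT R h (fun s => (dF (s / l) - dF ((s - c) / l)) / l) y x.
- by [].
- by move=> z /[!in_itv]/= ?; apply: dh; lra.
- apply: derivable_within_continuous => z /[!in_itv]/= /andP[yz _].
  by have [] := dh z (lt_le_trans cy yz).
rewrite in_itv/= => /andP[yz zx] hE.
rewrite -subr_lt0 hE pmulr_llt0 ?subr_gt0// pmulr_llt0 ?invr_gt0// subr_lt0.
rewrite /dF ltr_pM2l ?invr_gt0 ?sqrtr_gt0 ?pi_gt0// ltr_expR ltrN2 ltr_pM2r//.
rewrite ltr_pXn2r// ?nnegrE ?divr_ge0 ?ltW//; try lra.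
by rewrite ltr_pM2r ?invr_gt0//; lra.
Qed.

(** * The energy and its minimizer *)

Lemma OmegaP {R : realType} (xi : nat -> R) :
  Omega xi <-> forall j, 0 < xi j.+1 < xi j.
Proof.
split=> [[]//|xi_dec]; split=> //.
rewrite /= /bounded_near; near=> M => n _ /=.
have le0 : xi n <= xi 0%N.
  by elim: n => // n; apply: le_trans; have /andP[_ /ltW] := xi_dec n.
have gt0 : 0 < xi n.
  by have /andP[h1 h2] := xi_dec n; exact: lt_trans h2.
rewrite ger0_norm ?(ltW gt0)//.
apply: (le_trans le0).
by near: M; apply: nbhs_pinfty_ge; rewrite num_real.
Unshelve. all: by end_near. Qed.

Lemma Omega_gt0 {R : realType} (xi : nat -> R) : Omega xi -> forall j, 0 < xi j.
Proof. by move=> /OmegaP xi_dec j; have /andP[h1 h2] := xi_dec j; exact: lt_trans h2. Qed.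

Lemma Omega_lt {R : realType} (xi : nat -> R) : Omega xi -> forall j, xi j.+1 < xi j.
Proof. by move=> /OmegaP xi_dec j; have /andP[] := xi_dec j. Qed.

(** Gaussian mass of the i-th phase, the argument of the logarithm in the
    energy. *)
Definition gap {R : realType} (a xi : nat -> R) (i : nat) : R :=
  Fdiv a xi i i - Fdiv a xi i i.+1.

(** Replaces the extraction of a convergent subsequence: closed conditions which
    hold along the filter hold at its cluster points. *)
Lemma cluster_le {R : realType} {T : topologicalType} (G : set_system T) (p : T) (g : T -> R)
    (c : R) :
  cluster G p -> {for p, continuous g} -> G [set q | g q <= c] -> g p <= c.
Proof.
move=> Gp gp Gc; rewrite leNgt; apply/negP => cgp.
have /Gp /(_ (cvgr_gt _ gp _ cgp)) [q [/= qc]] := Gc.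
by rewrite ltNge qc.
Qed.

Section energy.
Context {R : realType} (u a k d : nat -> R).
Context (u01 : u 0%N <= u 1%N).
Context (u_incr : forall i : nat, (0 < i)%N -> u i < u i.+1).
Context (a_gt0 : forall i : nat, 0 < a i).
Context (k_gt0 : forall i : nat, 0 < k i).
Context (d_ge0 : forall i : nat, (0 < i)%N -> 0 <= d i).
Context (d1_gt0 : u 1%N = u 0%N -> 0 < d 1%N).

Let w i := k i * (u i.+1 - u i).

Definition energy_term (xi : nat -> R) (i : nat) : R :=
  - (k i * (u i.+1 - u i) * ln (gap a xi i)) + d i.+1 * xi i ^+ 2 / 4.

Definition energy_sum (xi : nat -> R) (n : nat) : R :=
  \sum_(0 <= i < n) energy_term xi i.

Lemma energy_sumS (xi : nat -> R) n :
  energy_sum xi n.+1 = energy_sum xi n + energy_term xi n.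
Proof. by rewrite /energy_sum big_nat_recr. Qed.

Lemma Fdiv0 (xi : nat -> R) l : Fdiv a xi l 0 = 1.
Proof. by rewrite /Fdiv/= mulyr gtr0_sg ?invr_gt0// mul1e. Qed.

Lemma gap0 (xi : nat -> R) : gap a xi 0 = 1 - F (xi 0%N / a 0%N)%:E.
Proof. by rewrite /gap Fdiv0. Qed.

Lemma gapS (xi : nat -> R) i :
  gap a xi i.+1 = F (xi i / a i.+1)%:E - F (xi i.+1 / a i.+1)%:E.
Proof. by []. Qed.

Lemma gap_gt0 (xi : nat -> R) i : Omega xi -> 0 < gap a xi i.
Proof.
move=> Oxi; have xi0 := Omega_gt0 _ Oxi.
case: i => [|i]; first by rewrite gap0 subr_gt0 F_lt1// divr_ge0// ltW.
rewrite gapS subr_gt0 F_lt ?divr_ge0 ?ltW//.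
by rewrite ltr_pM2r ?invr_gt0// Omega_lt.
Qed.

Lemma gap_lt1 (xi : nat -> R) i : Omega xi -> gap a xi i < 1.
Proof.
move=> Oxi; have xi0 := Omega_gt0 _ Oxi.
have Fpos j l : 0 < F (xi j / a l)%:E.
  by rewrite -[ltLHS]F0 F_lt// divr_gt0.
have F1 j l : F (xi j / a l)%:E < 1.
  by rewrite F_lt1// divr_ge0 ?ltW.
case: i => [|i]; first by rewrite gap0 ltrBlDr ltrDl.
by rewrite gapS ltrBlDr ltr_wpDr// ltW.
Qed.

Let w_ge0 i : 0 <= w i.
Proof.
apply: mulr_ge0; first exact/ltW.
by rewrite subr_ge0; case: i => // i; exact/ltW/u_incr.
Qed.

Let w_gt0 i : (0 < i)%N -> 0 < w i.
Proof. by move=> i0; rewrite mulr_gt0// subr_gt0 u_incr. Qed.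

Lemma energy_ln_ge0 (xi : nat -> R) i : Omega xi ->
  0 <= - (k i * (u i.+1 - u i) * ln (gap a xi i)).
Proof.
move=> Oxi; rewrite oppr_ge0 mulr_ge0_le0 ?w_ge0// ln_le0//.
exact/ltW/gap_lt1.
Qed.

Lemma energy_sqr_ge0 (xi : nat -> R) i : 0 <= d i.+1 * xi i ^+ 2 / 4.
Proof. by rewrite divr_ge0// mulr_ge0 ?d_ge0// sqr_ge0. Qed.

Lemma energy_term_ge0 (xi : nat -> R) i : Omega xi -> 0 <= energy_term xi i.
Proof. by move=> Oxi; rewrite addr_ge0 ?energy_ln_ge0 ?energy_sqr_ge0. Qed.

Lemma energy_sum_ndecr (xi : nat -> R) m n : Omega xi -> (m <= n)%N ->
  energy_sum xi m <= energy_sum xi n.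
Proof.
move=> Oxi mn; rewrite /energy_sum (big_cat_nat (leq0n m) mn)//= lerDl.
by rewrite sumr_ge0// => i _; exact: energy_term_ge0.
Qed.

(** The two series have nonnegative terms, so E is the supremum of the partial
    sums.  Every comparison of energies below is made on partial sums, which
    are real. *)
Lemma E_le (xi : nat -> R) (c : R) : Omega xi ->
  (E u a k d xi <= c%:E)%E <-> forall n, energy_sum xi n <= c.
Proof.
move=> Oxi.
have -> : E u a k d xi = (\sum_(0 <= i <oo) (energy_term xi i)%:E)%E.
  rewrite /E -nneseriesD => [|i _ _|i _ _].
  - by apply: eq_eseriesr => i _; rewrite -EFinD.
  - by rewrite lee_fin energy_ln_ge0.
  - by rewrite lee_fin energy_sqr_ge0.
split=> [Ec n|sc].
  rewrite -lee_fin; apply: le_trans Ec; rewrite /energy_sum -sumEFin.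
  by apply: nneseries_lim_ge => i _ _; rewrite lee_fin energy_term_ge0.
apply: lime_le.
  by apply: is_cvg_nneseries => i _ _; rewrite lee_fin energy_term_ge0.
by apply: nearW => n; rewrite sumEFin lee_fin; exact: sc.
Qed.

Lemma E_ge0 (xi : nat -> R) : Omega xi -> (0 <= E u a k d xi)%E.
Proof.
move=> Oxi; rewrite /E adde_ge0//; apply: nneseries_ge0 => i _ _.
  by rewrite lee_fin energy_ln_ge0.
by rewrite lee_fin energy_sqr_ge0.
Qed.

Context (E_proper : (ereal_inf (E u a k d @` Omega) < +oo)%E).

Lemma E_inf_fin : exists N : R, ereal_inf (E u a k d @` Omega) = N%:E.
Proof.
have : ereal_inf (E u a k d @` Omega) \is a fin_num.
  rewrite ge0_fin_numE//; apply: le_ereal_inf_tmp => _ [xi Oxi <-].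
  exact: E_ge0.
by move=> /fineK <-; eexists.
Qed.

Definition minimizer (xi : nat -> R) :=
  Omega xi /\ E u a k d xi = ereal_inf (E u a k d @` Omega).

Lemma inf_le_energy_sum_bound (eta : nat -> R) (m : nat) (c : R) : Omega eta ->
  (forall n, (m <= n)%N -> energy_sum eta n <= c) ->
  (ereal_inf (E u a k d @` Omega) <= c%:E)%E.
Proof.
move=> Oeta eta_c.
apply: (@le_trans _ _ (E u a k d eta)).
  by apply: ereal_inf_lbound; exists eta.
apply/(E_le _ _ Oeta) => n.
apply: le_trans (energy_sum_ndecr _ _ _ Oeta (leq_maxr m n)) _.
exact: eta_c _ (leq_maxl m n).
Qed.

(** A uniform gain on all large partial sums cannot be compensated further on in
    the series; this is how finite-dimensional variations are compared although
    E is an infinite sum. *)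
Lemma no_improvement (xi eta : nat -> R) (m : nat) (e : R) :
  minimizer xi -> Omega eta -> 0 < e ->
  (forall n, (m <= n)%N -> energy_sum eta n <= energy_sum xi n - e) -> False.
Proof.
move=> [Oxi]; have [N EN] := E_inf_fin; rewrite EN => Exi Oeta e0 better.
have /(E_le _ _ Oxi) xiN : (E u a k d xi <= N%:E)%E by rewrite Exi.
have : (ereal_inf (E u a k d @` Omega) <= (N - e)%:E)%E.
  apply: (inf_le_energy_sum_bound eta m) => // n mn.
  by apply: le_trans (better _ mn) _; rewrite lerD2r.
by rewrite EN lee_fin; lra.
Qed.

(** The midpoint of two distinct minimizers has smaller energy.  If they differ
    in xi j, the gain comes from the term of index j.+1: there xi j is the
    right endpoint and the weight is positive, which may fail for index 0. *)
Lemma minimizer_unique (xi eta : nat -> R) :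
  minimizer xi -> minimizer eta -> xi = eta.
Proof.
move=> mxi meta; apply/funext => j; apply/eqP; apply/negPn/negP => neq.
have [Oxi Exi] := mxi; have [Oeta Eeta] := meta.
have xi0 := Omega_gt0 _ Oxi; have eta0 := Omega_gt0 _ Oeta.
pose mid i := (xi i + eta i) / 2.
have Omid : Omega mid.
  apply/OmegaP => i; have := Omega_lt _ Oxi i; have := Omega_lt _ Oeta i.
  by have := xi0 i.+1; have := eta0 i.+1; rewrite /mid; lra.
have midE i l : (xi i / a l + eta i / a l) / 2 = mid i / a l.
  by rewrite /mid; field; rewrite gt_eqF.
have lnle i : ln (gap a xi i) + ln (gap a eta i) <= 2 * ln (gap a mid i).
  case: i => [|i].
    rewrite !gap0 -midE ln_1F_concave ?divr_gt0//.
  rewrite !gapS -!midE; apply: ln_F_concave;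
    by rewrite ?divr_gt0// ltr_pM2r ?invr_gt0// Omega_lt.
have lnlt : ln (gap a xi j.+1) + ln (gap a eta j.+1) < 2 * ln (gap a mid j.+1).
  rewrite !gapS -!midE; apply: ln_F_strictly_concave;
    rewrite ?divr_gt0// ?ltr_pM2r ?invr_gt0// ?Omega_lt//.
  apply: contra_neq neq => -[+ _] => /(congr1 ( *%R^~ (a j.+1))).
  by rewrite !divfK ?gt_eqF.
have sqr i : 2 * (d i.+1 * mid i ^+ 2 / 4) <=
    d i.+1 * xi i ^+ 2 / 4 + d i.+1 * eta i ^+ 2 / 4.
  rewrite -subr_ge0 (_ : _ - _ = d i.+1 * (xi i - eta i) ^+ 2 / 8); last first.
    by rewrite /mid; field.
  by rewrite divr_ge0// mulr_ge0 ?d_ge0// sqr_ge0.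
have term_le i : 2 * energy_term mid i <= energy_term xi i + energy_term eta i.
  rewrite /energy_term; have := sqr i.
  have : w i * (ln (gap a xi i) + ln (gap a eta i)) <= w i * (2 * ln (gap a mid i)).
    by rewrite ler_wpM2l.
  rewrite -/(w i); move: (w i) (ln _) (ln _) (ln _) (_ / 4) (_ / 4) (_ / 4).
  by move=> W l1 l2 l3 s1 s2 s3; lra.
pose e := w j.+1 * (2 * ln (gap a mid j.+1) - (ln (gap a xi j.+1) + ln (gap a eta j.+1))).
have e0 : 0 < e by rewrite mulr_gt0 ?w_gt0// subr_gt0.
have term_lt : 2 * energy_term mid j.+1 <= energy_term xi j.+1 + energy_term eta j.+1 - e.
  by rewrite /energy_term; have := sqr j.+1; rewrite /e /w; lra.
have sum_le n : (j.+2 <= n)%N ->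
    2 * energy_sum mid n <= energy_sum xi n + energy_sum eta n - e.
  elim: n => // n IHn; rewrite ltnS leq_eqVlt => /predU1P[<-|jn].
    have : 2 * energy_sum mid j.+1 <= energy_sum xi j.+1 + energy_sum eta j.+1.
      by rewrite /energy_sum mulr_sumr -big_split/= ler_sum.
    by rewrite !(energy_sumS _ j.+1); lra.
  rewrite !energy_sumS.
  by have := IHn jn; have := term_le n; lra.
have [N EN] := E_inf_fin.
have /(E_le _ _ Oxi) xiN : (E u a k d xi <= N%:E)%E by rewrite Exi EN.
have /(E_le _ _ Oeta) etaN : (E u a k d eta <= N%:E)%E by rewrite Eeta EN.
have : (ereal_inf (E u a k d @` Omega) <= (N - e / 2)%:E)%E.
  apply: (inf_le_energy_sum_bound mid j.+2) => // n jn.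
  by have := sum_le _ jn; have := xiN n; have := etaN n; lra.
by rewrite EN lee_fin; lra.
Qed.

(** If the limit L were positive, then xi - L would be a better competitor. *)
Lemma minimizer_cvg0 (xi : nat -> R) : minimizer xi -> xi i @[i --> \oo] --> 0.
Proof.
move=> mxi; have [Oxi Exi] := mxi.
have xi0 := Omega_gt0 _ Oxi; have xilt := Omega_lt _ Oxi.
have nincr : nonincreasing_seq xi.
  by apply/nonincreasing_seqP => n; exact/ltW.
have lb : has_lbound (range xi) by exists 0 => _ [i _ <-]; exact/ltW.
have cxi := nonincreasing_cvgn nincr lb.
set L := inf _ in cxi.
have Llt i : L < xi i.
  apply: le_lt_trans (xilt i); apply: (ge_inf lb).
  by exists i.+1.
have L0 : 0 <= L.
  by apply: lb_le_inf => [|_ [i _ <-]]; [exists (xi 0%N), 0%N|exact/ltW].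
move: L0; rewrite le_eqVlt => /predU1P[L0|L0]; first by rewrite L0.
exfalso; pose eta i := xi i - L.
have Oeta : Omega eta.
  by apply/OmegaP => j; rewrite /eta subr_gt0 Llt/= ltrD2r.
have gaplt i : gap a xi i < gap a eta i.
  case: i => [|i]; last first.
    by rewrite !gapS; apply: F_shift_lt.
  rewrite !gap0 ltrD2l ltrN2 F_lt//.
    by rewrite divr_ge0 ?ltW// subr_gt0.
  by rewrite ltr_pM2r ?invr_gt0// gtrBl.
have sqr i : d i.+1 * eta i ^+ 2 / 4 <= d i.+1 * xi i ^+ 2 / 4.
  rewrite ler_pM2r// ler_wpM2l ?d_ge0//.
  rewrite ler_pXn2r// ?nnegrE ?ltW// ?subr_gt0//.
  by rewrite gtrBl.
have lnlt i : ln (gap a xi i) < ln (gap a eta i).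
  by rewrite ltr_ln ?posrE ?gap_gt0.
have term_le i : energy_term eta i <= energy_term xi i.
  by rewrite lerD// lerN2 ler_wpM2l ?w_ge0// ltW.
pose e := w 1%N * (ln (gap a eta 1%N) - ln (gap a xi 1%N)).
have e0 : 0 < e by rewrite mulr_gt0 ?w_gt0// subr_gt0.
(* the term of index 1, whose weight is positive, provides the uniform gain *)
apply: (@no_improvement xi eta 2 e mxi Oeta e0) => n.
elim: n => // n IHn; rewrite ltnS leq_eqVlt => /predU1P[<-|n1].
  rewrite !energy_sumS /energy_sum !big_geq// !add0r.
  have := term_le 0%N; have := sqr 1%N; rewrite /energy_term /e /w; lra.
rewrite !energy_sumS.
by have := IHn n1; have := term_le n; lra.
Qed.

(** Fermat's rule for the j-th coordinate, which can move freely between its two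
    neighbours.  It occurs in the logarithms of index j (as left endpoint) and
    j.+1 (as right endpoint) and in one square; f below is the sum of these
    three terms. *)
Lemma minimizer_stationary (xi : nat -> R) (j : nat) : minimizer xi ->
  d j.+1 * xi j / 2
  + k j * (u j.+1 - u j) * (dF (xi j / a j) / a j) / gap a xi j
  - k j.+1 * (u j.+2 - u j.+1) * (dF (xi j / a j.+1) / a j.+1) / gap a xi j.+1
  = 0.
Proof.
move=> mxi; have [Oxi Exi] := mxi.
have xi0 := Omega_gt0 _ Oxi; have xilt := Omega_lt _ Oxi.
pose eta (s : R) i := if i == j then s else xi i.
(* upper end of the range of the moving coordinate; there is none for j = 0 *)
pose b := if j is i.+1 then xi i else xi j + 1.
have xib : xi j < b by rewrite /b; case: (j) => [|i]; rewrite ?xilt ?ltrDl.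
pose C := Fdiv a xi j j; pose D := Fdiv a xi j.+1 j.+2.
pose f (s : R) := - (w j * ln (C - F (s / a j)%:E))
  - w j.+1 * ln (F (s / a j.+1)%:E - D) + d j.+1 * s ^+ 2 / 4.
have etaj s : eta s j = s by rewrite /eta eqxx.
have etaN s i : i != j -> eta s i = xi i by rewrite /eta => /negPf ->.
have Oeta s : xi j.+1 < s < b -> Omega (eta s).
  move=> /andP[js sb]; apply/OmegaP => i.
  have [-> | ij] := eqVneq i j.
    by rewrite etaj etaN ?xi0// -[X in _ == X]addn0 -addn1 eqn_add2l.
  rewrite (etaN _ _ ij).
  have [ij1 | ij1] := eqVneq i.+1 j; last by rewrite etaN// xi0 xilt.
  rewrite ij1 etaj (lt_trans (xi0 j.+1))//=.
  by move: sb; rewrite /b -ij1.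
have gap_eta s i : i != j -> i != j.+1 -> gap a (eta s) i = gap a xi i.
  case: i => [|i] ij ij1; first by rewrite !gap0 etaN.
  by rewrite !gapS !etaN.
have gap_etaj s : gap a (eta s) j = C - F (s / a j)%:E.
  rewrite /gap /C [Fdiv _ _ _ j.+1]/Fdiv/= etaj; congr (_ - _).
  by rewrite /Fdiv; case: (j) etaN => // i etaN; rewrite /= etaN// neq_ltn ltnSn.
have gap_etaSj s : gap a (eta s) j.+1 = F (s / a j.+1)%:E - D.
  by rewrite gapS etaj etaN// neq_ltn ltnSn orbT.
have gap_xij : C - F (xi j / a j)%:E = gap a xi j by [].
have gap_xiSj : F (xi j / a j.+1)%:E - D = gap a xi j.+1 by [].
have sumE s n : (j.+2 <= n)%N ->
    energy_sum (eta s) n = energy_sum xi n + (f s - f (xi j)).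
  have base m : (m <= j)%N -> energy_sum (eta s) m = energy_sum xi m.
    move=> mj; rewrite /energy_sum !big_nat; apply: eq_bigr => i /andP[_ im].
    have ij : (i < j)%N by exact: leq_trans mj.
    by rewrite /energy_term gap_eta ?etaN// ltn_eqF// ltnW.
  elim: n => // n IHn; rewrite ltnS leq_eqVlt => /predU1P[<-|jn].
    rewrite !energy_sumS base// /energy_term gap_etaj gap_etaSj etaj.
    rewrite etaN ?neq_ltn ?ltnSn ?orbT// /f gap_xij gap_xiSj /w.
    by ring.
  rewrite !energy_sumS IHn// /energy_term gap_eta ?etaN; first by ring.
  - by rewrite gtn_eqF// ltnW.
  - by rewrite gtn_eqF// ltnW.
  - by rewrite gtn_eqF.
have gaps s : xi j.+1 < s < b ->
    0 < C - F (s / a j)%:E /\ 0 < F (s / a j.+1)%:E - D.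
  by move=> /Oeta Oe; rewrite -gap_etaj -gap_etaSj !gap_gt0.
pose f' (s : R) := d j.+1 * s / 2
  + w j * (dF (s / a j) / a j) / (C - F (s / a j)%:E)
  - w j.+1 * (dF (s / a j.+1) / a j.+1) / (F (s / a j.+1)%:E - D).
have df s : xi j.+1 < s < b -> is_derive s 1 f (f' s).
  move=> sI; have [g1 g2] := gaps _ sI.
  have s0 : 0 < s by case/andP: sI => h _; exact: lt_trans h.
  have dFa l : 0 < l -> is_derive s 1 (fun s => F (s / l)%:E) (dF (s / l) / l).
    move=> l0; have sl0 : 0 < s / l by rewrite divr_gt0.
    have d0 := is_derive_F _ sl0.
    have dv : is_derive s 1 (fun s : R => s / l) l^-1.
      by apply: is_derive_eq; rewrite /GRing.scale/=; ring.
    exact: (@is_derive1_comp _ (fun z => F z%:E)).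
  have d1 := dFa _ (a_gt0 j); have d2 := dFa _ (a_gt0 j.+1).
  have d3 := is_deriveB (is_derive_cst C s (1 : R)) d1.
  have d4 := is_deriveB d2 (is_derive_cst D s (1 : R)).
  have l3 := @is_derive1_comp _ (@ln R) (fun s => C - F (s / a j)%:E) _ _ _
    (is_derive1_ln g1) d3.
  have l4 := @is_derive1_comp _ (@ln R) (fun s => F (s / a j.+1)%:E - D) _ _ _
    (is_derive1_ln g2) d4.
  have d5 : is_derive s 1 (fun s : R => d j.+1 * s ^+ 2 / 4) (d j.+1 * s / 2).
    by apply: is_derive_eq; rewrite /GRing.scale/=; field.
  have l3' := is_deriveN (is_deriveZ (w j) l3).
  have l4' := is_deriveZ (w j.+1) l4.
  apply: (@is_derive_eq _ _ _ f _ _ _ _ (is_deriveD (is_deriveB l3' l4') d5)).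
  by rewrite /f' /GRing.scale/=; ring.
have xiI : xi j.+1 < xi j < b by rewrite xilt.
have [_ f'E] := df _ xiI.
suff [_ f'0] : is_derive (xi j) 1 f 0.
  by move: f'E; rewrite f'0 /f' gap_xij gap_xiSj.
apply: (@derive1_at_min R f (xi j.+1) b (xi j)) => [|t||t].
- by rewrite ltW// (lt_trans (xilt j)).
- by move=> /[!in_itv]/= tI; have [] := df _ tI.
- by rewrite in_itv.
move=> /[!in_itv]/= tI; rewrite leNgt; apply/negP => ft.
apply: (@no_improvement xi (eta t) j.+2 (f (xi j) - f t) mxi (Oeta _ tI)).
  by rewrite subr_gt0.
by move=> n jn; rewrite sumE// opprB.
Qed.

(** A bound on the energy keeps the mass of each phase of positive weight away
    from 0, uniformly over the sublevel set. *)
Lemma gap_lower_bound (xi : nat -> R) (i : nat) (c : R) : Omega xi ->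
  0 < k i * (u i.+1 - u i) -> energy_sum xi i.+1 <= c ->
  expR (- (c / (k i * (u i.+1 - u i)))) <= gap a xi i.
Proof.
move=> Oxi wi0; rewrite energy_sumS => sc.
rewrite -[leRHS]lnK ?posrE ?gap_gt0// ler_expR lerNl ler_pdivlMr// mulrC mulrN.
apply: le_trans sc; rewrite -[leLHS]add0r; apply: lerD.
  have := energy_sum_ndecr xi 0 i Oxi (leq0n i).
  by rewrite {1}/energy_sum big_geq.
by rewrite /energy_term lerDl energy_sqr_ge0.
Qed.

(** A large first coordinate is penalized by the small mass 1 - F (xi_1 / a_0)
    of phase 0 if u_0 < u_1, and by the term d_1 xi_1^2 / 4 if u_0 = u_1. *)
Lemma first_coordinate_bound (c : R) : exists M, forall xi : nat -> R,
  Omega xi -> (forall n, energy_sum xi n <= c) -> xi 0%N <= M.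
Proof.
move: u01; rewrite le_eqVlt => /predU1P[u0E|u0lt].
  have d10 := d1_gt0 (esym u0E).
  exists (1 + c * 4 / d 1%N) => xi Oxi /(_ 1%N).
  rewrite energy_sumS {1}/energy_sum big_geq// add0r /energy_term => sc.
  have {sc} : xi 0%N ^+ 2 <= c * 4 / d 1%N.
    rewrite ler_pdivlMr// mulrC -ler_pdivrMr//.
    by apply: le_trans sc; rewrite lerDr energy_ln_ge0.
  have := sqr_ge0 (xi 0%N - 1); nra.
have w0 : 0 < k 0%N * (u 1%N - u 0%N) by rewrite mulr_gt0// subr_gt0.
set e := expR (- (c / (k 0%N * (u 1%N - u 0%N)))).
have [Z Z0 FZ] : exists2 Z : R, 0 <= Z & 1 - e < F Z%:E.
  suff : \forall Z \near +oo%R, 0 <= Z /\ 1 - e < F (Z : R)%:E.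
    by move=> /filter_ex[Z []]; exists Z.
  near=> Z; split; near: Z.
    by apply: nbhs_pinfty_ge; rewrite num_real.
  by apply: (cvgr_gt _ (@cvg_F R)); rewrite gtrBl expR_gt0.
exists (Z * a 0%N) => xi Oxi sc; rewrite leNgt; apply/negP => Zxi.
have := gap_lower_bound _ _ _ Oxi w0 (sc 1%N); rewrite -/e gap0.
suff : F Z%:E <= F (xi 0%N / a 0%N)%:E by lra.
by rewrite F_le// ler_pdivlMr// ltW.
Unshelve. all: by end_near. Qed.

(** Convergence of the coordinates suffices because a partial sum only involves
    finitely many of them. *)
Lemma cvg_energy_sum (G : set_system (nat -> R)) (xi : nat -> R) (n : nat) :
  Filter G -> Omega xi -> (forall j, eta j @[eta --> G] --> xi j) ->
  energy_sum eta n @[eta --> G] --> energy_sum xi n.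
Proof.
move=> FG Oxi cproj; have xi0 := Omega_gt0 _ Oxi.
have cF j l : F (eta j / a l)%:E @[eta --> G] --> F (xi j / a l)%:E.
  have lj : eta j / a l @[eta --> G] --> xi j / a l.
    by apply: cvgM; [exact: cproj|exact: cvg_cst].
  have xijl : 0 < xi j / a l by rewrite divr_gt0.
  have [dFj _] := is_derive_F _ xijl.
  have cFj : {for xi j / a l, continuous (fun z => F z%:E)}.
    exact/differentiable_continuous/derivable1_diffP.
  exact: (cvg_comp _ _ lj cFj).
have cgap i : gap a eta i @[eta --> G] --> gap a xi i.
  case: i => [|i]; last by apply: cvgB; exact: cF.
  rewrite gap0; under eq_fun do rewrite gap0.
  by apply: cvgB; [exact: cvg_cst|exact: cF].
have cterm i : energy_term eta i @[eta --> G] --> energy_term xi i.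
  apply: cvgD.
    apply: cvgN; apply: cvgM; first exact: cvg_cst.
    exact: (cvg_comp _ _ (cgap i) (continuous_ln (gap_gt0 _ i Oxi))).
  apply: cvgM; last exact: cvg_cst.
  apply: cvgM; first exact: cvg_cst.
  by rewrite expr2; under eq_fun do rewrite expr2; apply: cvgM; exact: cproj.
elim: n => [|n IHn].
  rewrite /energy_sum big_geq//; under eq_fun do rewrite big_geq//.
  exact: cvg_cst.
rewrite energy_sumS; under eq_fun do rewrite energy_sumS.
by apply: cvgD; [exact: IHn|exact: cterm].
Qed.

(* sequences carry the topology of pointwise convergence in the next proof *)
Import ArrowAsProduct.
Lemma minimizer_exists : exists xi, minimizer xi.
Proof.
have [N EN] := E_inf_fin.
have /choice[X XP] : forall m : nat, exists xi : nat -> R, Omega xi /\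
    forall n, energy_sum xi n <= N + m.+1%:R^-1.
  move=> m.
  have m0 : 0 < m.+1%:R^-1 :> R by rewrite invr_gt0.
  have [|_ [xi Oxi <-] xiN] :=
    @lb_ereal_inf_adherent R (E u a k d @` Omega) _ m0.
    by rewrite EN.
  exists xi; split=> //; apply/(E_le _ _ Oxi).
  by apply: ltW; move: xiN; rewrite EN.
have OX m := (XP m).1.
have XN1 m n : energy_sum (X m) n <= N + 1.
  apply: le_trans ((XP m).2 n) _.
  by rewrite lerD2l invf_le1 ?ler1n.
have [M XM] := first_coordinate_bound (N + 1).
have X0M m i : X m i \in `[0, M].
  rewrite in_itv/= ltW ?(Omega_gt0 _ (OX m))//=.
  apply: le_trans (XM _ (OX m) (XN1 m)).
  by elim: i => // i; apply: le_trans; exact/ltW/Omega_lt.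
have cK := @tychonoff nat (fun _ => R) (fun _ => `[0, M]%classic)
  (fun _ => @segment_compact R 0 M).
have [p [/= pK Xp]] : [set f : nat -> R | forall i, `[0, M]%classic (f i)]
    `&` cluster (X @ \oo) !=set0.
  by apply: cK; exists 0%N => // m _ i /=; exact: X0M.
have cproj j : {for p, continuous (fun q : nat -> R => q j)}.
  exact: (@proj_continuous _ (fun _ : nat => R) j p).
(* the strict inequalities are stable under the limit: F is Lipschitz, so the
   lower bound on the gaps is one on the differences of the coordinates *)
have p_lt i : p i.+1 < p i.
  have wi0 : 0 < k i.+1 * (u i.+2 - u i.+1) by exact: w_gt0.
  set e := expR (- ((N + 1) / (k i.+1 * (u i.+2 - u i.+1)))).
  have e0 : 0 < Num.sqrt pi * e * a i.+1.
    by rewrite !mulr_gt0 ?expR_gt0// sqrtr_gt0 pi_gt0.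
  suff : p i.+1 - p i <= - (Num.sqrt pi * e * a i.+1) by lra.
  apply: (@cluster_le _ _ (X @ \oo) p (fun q : nat -> R => q i.+1 - q i)) => //.
    exact: (cvgB (cproj i.+1) (cproj i)).
  exists 0%N => // m _ /=; rewrite lerNr opprB -mulrA mulrC -ler_pdivlMr ?sqrtr_gt0 ?pi_gt0//.
  have := gap_lower_bound _ _ _ (OX m) wi0 (XN1 m i.+2).
  rewrite -/e gapS => egap; rewrite -ler_pdivlMr//.
  apply: le_trans egap _.
  apply: le_trans (F_lipschitz _ _ _ _) _.
  - by rewrite divr_ge0 ?ltW// (Omega_gt0 _ (OX m)).
  - by rewrite ltr_pM2r ?invr_gt0// (Omega_lt _ (OX m)).
  by rewrite -mulrBl mulrC mulrAC.
have Op : Omega p.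
  apply/OmegaP => i; rewrite p_lt andbT.
  apply: le_lt_trans (p_lt i.+1).
  by have /[!in_itv]/= /andP[] := pK i.+2.
exists p; split=> //; rewrite EN; apply/eqP; rewrite eq_le; apply/andP; split.
  apply/(E_le _ _ Op) => n; apply/ler_addgt0Pr => e e0.
  apply: (@cluster_le _ _ (X @ \oo) p (energy_sum ^~ n)) => //.
    exact: (cvg_energy_sum (nbhs p) p n _ Op cproj).
  change (\forall m \near \oo, energy_sum (X m) n <= N + e).
  near=> m; apply: le_trans ((XP m).2 n) _.
  rewrite lerD2l; apply: ltW; near: m.
  exact: near_infty_natSinv_lt (PosNum e0).
by rewrite -EN; apply: ereal_inf_lbound; exists p.
Unshelve. all: by end_near. Qed.

End energy.

(** * An algebra of smooth functions of time and space *)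

(** Expressions for functions of (t, x), interpreted by [heval] for a fixed a:
    HInvSqrt is 1 / sqrt t, and HDensity and HError are dF and F at the
    similarity variable x / (a sqrt t).  Since the functions they denote are
    closed under both partial derivatives, smoothness at all orders reduces to
    one differentiation. *)
Inductive heat_expr (R : Type) : Type :=
| HConst of R
| HTime
| HSpace
| HInvSqrt
| HDensity
| HError
| HAdd of heat_expr R & heat_expr R
| HMul of heat_expr R & heat_expr R.

Arguments HConst {R}.
Arguments HTime {R}.
Arguments HSpace {R}.
Arguments HInvSqrt {R}.
Arguments HDensity {R}.
Arguments HError {R}.
Arguments HAdd {R}.
Arguments HMul {R}.

Local Arguments F : simpl never.

Section heat_expr.
Context {R : realType} (a : R) (a_gt0 : 0 < a).

Fixpoint heval (e : heat_expr R) (t x : R) : R :=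
  match e with
  | HConst c => c
  | HTime => t
  | HSpace => x
  | HInvSqrt => (Num.sqrt t)^-1
  | HDensity => dF (x / Num.sqrt t / a)
  | HError => F (x / Num.sqrt t / a)%:E
  | HAdd e1 e2 => heval e1 t x + heval e2 t x
  | HMul e1 e2 => heval e1 t x * heval e2 t x
  end.

Definition hsimilarity : heat_expr R :=
  HMul HSpace (HMul HInvSqrt (HConst a^-1)).

(** The time derivative of x / (a sqrt t) is - x / (2 a t^(3/2)). *)
Definition hsimilarity_t : heat_expr R :=
  HMul (HConst (- (2 * a)^-1))
    (HMul HSpace (HMul HInvSqrt (HMul HInvSqrt HInvSqrt))).

Definition hsimilarity_x : heat_expr R := HMul HInvSqrt (HConst a^-1).

(** Symbolic derivation, determined by the derivatives of t, of x, of
    1 / sqrt t and of the similarity variable. *)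
Fixpoint hderiv (dtime dspace dinvsqrt dsim e : heat_expr R) : heat_expr R :=
  let D := hderiv dtime dspace dinvsqrt dsim in
  match e with
  | HConst _ => HConst 0
  | HTime => dtime
  | HSpace => dspace
  | HInvSqrt => dinvsqrt
  | HDensity => HMul (HMul (HConst (- 2^-1)) (HMul hsimilarity HDensity)) dsim
  | HError => HMul HDensity dsim
  | HAdd e1 e2 => HAdd (D e1) (D e2)
  | HMul e1 e2 => HAdd (HMul e1 (D e2)) (HMul e2 (D e1))
  end.

Definition hderiv_t : heat_expr R -> heat_expr R :=
  hderiv (HConst 1) (HConst 0)
    (HMul (HConst (- 2^-1)) (HMul HInvSqrt (HMul HInvSqrt HInvSqrt)))
    hsimilarity_t.

Definition hderiv_x : heat_expr R -> heat_expr R :=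
  hderiv (HConst 0) (HConst 1) (HConst 0) hsimilarity_x.

Lemma hsimilarity_gt0 (t x : R) : 0 < t -> 0 < x -> 0 < x / Num.sqrt t / a.
Proof. by move=> t0 x0; rewrite !divr_gt0// sqrtr_gt0. Qed.

Lemma is_derive_heval_x e (t x : R) : 0 < t -> 0 < x ->
  is_derive x 1 (heval e t) (heval (hderiv_x e) t x).
Proof.
move=> t0 x0; have z0 := hsimilarity_gt0 _ _ t0 x0.
have dz : is_derive x 1 (fun x : R => x / Num.sqrt t / a) (heval hsimilarity_x t x).
  by apply: is_derive_eq; rewrite /GRing.scale/=; ring.
elim: e => [c|||||| e1 IH1 e2 IH2| e1 IH1 e2 IH2] /=.
- exact: is_derive_cst.
- exact: is_derive_cst.
- exact: is_derive_id.
- exact: is_derive_cst.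
- have d1 := is_derive_dF (x / Num.sqrt t / a).
  have d2 := @is_derive1_comp _ (@dF R) (fun x : R => x / Num.sqrt t / a) _ _ _ d1 dz.
  apply: (@is_derive_eq _ _ _ _ _ _ _ _ d2) => /=.
  by ring.
- have d1 := is_derive_F _ z0.
  exact: (@is_derive1_comp _ (fun z => F z%:E) (fun x : R => x / Num.sqrt t / a) _ _ _ d1 dz).
- exact: (is_deriveD IH1 IH2).
- exact: (is_deriveM IH1 IH2).
Qed.

Lemma is_derive_heval_t e (t x : R) : 0 < t -> 0 < x ->
  is_derive t 1 (heval e ^~ x) (heval (hderiv_t e) t x).
Proof.
move=> t0 x0; have z0 := hsimilarity_gt0 _ _ t0 x0.
have st0 : Num.sqrt t != 0 by rewrite gt_eqF// sqrtr_gt0.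
have dp : is_derive t 1 (fun t : R => (Num.sqrt t)^-1)
    (- 2^-1 * ((Num.sqrt t)^-1 * ((Num.sqrt t)^-1 * (Num.sqrt t)^-1))).
  have ds := is_derive1_sqrt t0.
  apply: (@is_derive_eq _ _ _ _ _ _ _ _ (is_derive1_inv _ _ _ st0 ds)).
  by field.
have dz : is_derive t 1 (fun t : R => x / Num.sqrt t / a) (heval hsimilarity_t t x).
  apply: is_derive_eq; rewrite /GRing.scale/=; field.
  by rewrite st0 gt_eqF.
elim: e => [c|||||| e1 IH1 e2 IH2| e1 IH1 e2 IH2] /=.
- exact: is_derive_cst.
- exact: is_derive_id.
- exact: is_derive_cst.
- exact: dp.
- have d1 := is_derive_dF (x / Num.sqrt t / a).
  have d2 := @is_derive1_comp _ (@dF R) (fun t : R => x / Num.sqrt t / a) _ _ _ d1 dz.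
  apply: (@is_derive_eq _ _ _ _ _ _ _ _ d2) => /=.
  by ring.
- have d1 := is_derive_F _ z0.
  exact: (@is_derive1_comp _ (fun z => F z%:E) (fun t : R => x / Num.sqrt t / a) _ _ _ d1 dz).
- exact: (is_deriveD IH1 IH2).
- exact: (is_deriveM IH1 IH2).
Qed.

Lemma cvg_similarity (t x : R) : 0 < t ->
  q.2 / Num.sqrt q.1 @[q --> (t, x)] --> x / Num.sqrt t.
Proof.
move=> t0; have st0 : Num.sqrt t != 0 by rewrite gt_eqF// sqrtr_gt0.
apply: cvgM; first exact: cvg_snd.
apply: cvgV => //.
have ct : q.1 @[q --> (t, x)] --> t by exact: cvg_fst.
exact: (cvg_comp _ _ ct (@sqrt_continuous R t)).
Qed.

Lemma continuous_heval e : continuous_on_quadrant (heval e).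
Proof.
move=> [t x] [/= t0 x0]; rewrite /prop_for /continuous_at/=.
have z0 := hsimilarity_gt0 _ _ t0 x0.
have st0 : Num.sqrt t != 0 by rewrite gt_eqF// sqrtr_gt0.
have ct : q.1 @[q --> (t, x)] --> t by exact: cvg_fst.
have cx : q.2 @[q --> (t, x)] --> x by exact: cvg_snd.
have cp : (Num.sqrt q.1)^-1 @[q --> (t, x)] --> (Num.sqrt t)^-1.
  apply: cvgV => //.
  exact: (cvg_comp _ _ ct (@sqrt_continuous R t)).
have cz : q.2 / Num.sqrt q.1 / a @[q --> (t, x)] --> x / Num.sqrt t / a.
  by apply: cvgM; [exact: cvg_similarity|exact: cvg_cst].
elim: e => [c|||||| e1 IH1 e2 IH2| e1 IH1 e2 IH2] /=.
- exact: cvg_cst.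
- exact: ct.
- exact: cx.
- exact: cp.
- have [d1 _] := is_derive_dF (x / Num.sqrt t / a).
  have c1 : {for x / Num.sqrt t / a, continuous (@dF R)}.
    exact/differentiable_continuous/derivable1_diffP.
  exact: (cvg_comp _ _ cz c1).
- have [d1 _] := is_derive_F _ z0.
  have c1 : {for x / Num.sqrt t / a, continuous (fun z => F z%:E)}.
    exact/differentiable_continuous/derivable1_diffP.
  exact: (cvg_comp _ _ cz c1).
- exact: cvgD.
- exact: cvgM.
Qed.

Lemma near_pos (t : R) : 0 < t -> \forall s \near t, 0 < s.
Proof. by move=> t0; exact: (cvgr_gt _ (@cvg_id _ (nbhs t)) _ t0). Qed.

Lemma near_quadrant (p : R * R) : quadrant p -> \forall q \near p, quadrant q.
Proof.
move=> [p1 p2].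
have c1 : q.1 @[q --> p] --> p.1 by exact: cvg_fst.
have c2 : q.2 @[q --> p] --> p.2 by exact: cvg_snd.
near=> q; split; near: q; [exact: (cvgr_gt _ c1)|exact: (cvgr_gt _ c2)].
Unshelve. all: by end_near. Qed.

(** The next three lemmas transfer the calculus of expressions to a function
    which agrees with an expression only locally, such as a solution inside one
    layer. *)
Lemma near_heval_x e (v : R -> R -> R) (t x : R) : 0 < t -> 0 < x ->
  (\forall y \near x, v t y = heval e t y) ->
  is_derive x 1 (v t) (heval (hderiv_x e) t x).
Proof.
move=> t0 x0 vE; apply: near_eq_is_derive (is_derive_heval_x e _ _ t0 x0).
by apply: filterS vE => y ->.
Qed.

Lemma near_heval_t e (v : R -> R -> R) (t x : R) : 0 < t -> 0 < x ->
  (\forall s \near t, v s x = heval e s x) ->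
  is_derive t 1 (v ^~ x) (heval (hderiv_t e) t x).
Proof.
move=> t0 x0 vE; apply: near_eq_is_derive (is_derive_heval_t e _ _ t0 x0).
by apply: filterS vE => y ->.
Qed.

Lemma near_heval_continuous e (v : R -> R -> R) (p : R * R) : quadrant p ->
  (\forall q \near p, v q.1 q.2 = heval e q.1 q.2) ->
  {for p, continuous (fun q : R * R => v q.1 q.2)}.
Proof.
move=> qp vE; have := continuous_heval e p qp.
rewrite /prop_for /continuous_at (nbhs_singleton vE).
by apply: cvg_trans; apply: near_eq_cvg; apply: filterS vE => q ->.
Qed.

Lemma smooth_heval e (v : R -> R -> R) :
  (forall t x, quadrant (t, x) -> v t x = heval e t x) -> smooth v.
Proof.
move=> vE n; elim: n v e vE => [|n IHn] v e vE.
  split=> // p qp; apply: (near_heval_continuous e) => //.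
  by apply: filterS (near_quadrant _ qp) => -[? ?]; exact: vE.
have dt t x : quadrant (t, x) ->
    is_derive t 1 (v ^~ x) (heval (hderiv_t e) t x).
  move=> [/= t0 x0]; apply: near_heval_t => //.
  by apply: filterS (near_pos _ t0) => s s0; exact: vE.
have dx t x : quadrant (t, x) ->
    is_derive x 1 (v t) (heval (hderiv_x e) t x).
  move=> [/= t0 x0]; apply: near_heval_x => //.
  by apply: filterS (near_pos _ x0) => s s0; exact: vE.
split; first by have := IHn v e vE; case: (n) => [|m] [].
split.
- by move=> t x q; split; [have [] := dt _ _ q|have [] := dx _ _ q].
- apply: (IHn _ (hderiv_t e)) => t x q; rewrite /partial_t derive1E.
  by have [_ ->] := dt _ _ q.
- apply: (IHn _ (hderiv_x e)) => t x q; rewrite /partial_x derive1E.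
  by have [_ ->] := dx _ _ q.
Qed.

Definition similarity_expr (A B : R) : heat_expr R :=
  HAdd (HConst A) (HMul (HConst B) HError).

(** Both sides equal - B x dF (x / (a sqrt t)) / (2 a t^(3/2)). *)
Lemma similarity_heat (A B t x : R) : 0 < t ->
  heval (hderiv_t (similarity_expr A B)) t x =
  a ^+ 2 * heval (hderiv_x (hderiv_x (similarity_expr A B))) t x.
Proof.
move=> t0; have st0 : Num.sqrt t != 0 by rewrite gt_eqF// sqrtr_gt0.
rewrite /hderiv_t /hderiv_x /=.
move: (F _) (dF _) => f g; field.
by rewrite st0 gt_eqF.
Qed.

End heat_expr.

(** * The self-similar profile *)

Definition phase_fun {R : realType} (u a xi : nat -> R) (i : nat) (z : R) : R :=
  u i + (u i.+1 - u i) / (Fdiv a xi i i.+1 - Fdiv a xi i i)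
        * (F (z / a i)%:E - Fdiv a xi i i).

(** The i-th layer is the interval of the similarity variable occupied by phase
    i. *)
Definition layer {R : realType} (xi : nat -> R) (i : nat) (z : R) : bool :=
  (ext xi i.+1 < z%:E < ext xi i)%E.

Section profile.
Context {R : realType} (u a k d : nat -> R).
Context (u01 : u 0%N <= u 1%N).
Context (u_incr : forall i : nat, (0 < i)%N -> u i < u i.+1).
Context (a_gt0 : forall i : nat, 0 < a i).
Context (xi : nat -> R) (Oxi : Omega xi) (xi_cvg0 : xi i @[i --> \oo] --> 0).

Let xi0 := Omega_gt0 _ Oxi.

Lemma Omega_le i j : (i <= j)%N -> xi j <= xi i.
Proof.
move=> ij; have /nonincreasing_seqP : forall n, xi n.+1 <= xi n.
  by move=> n; exact/ltW/Omega_lt.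
exact.
Qed.

Lemma u_ndecr i j : (i <= j)%N -> u i <= u j.
Proof.
move=> ij; have /nondecreasing_seqP : forall n, u n <= u n.+1.
  by case=> // n; exact/ltW/u_incr.
exact.
Qed.

Lemma layer0 z : layer xi 0 z = (xi 0%N < z).
Proof. by rewrite /layer/= lte_fin ltry andbT. Qed.

Lemma layerS i z : layer xi i.+1 z = (xi i.+1 < z < xi i).
Proof. by rewrite /layer/= !lte_fin. Qed.

Lemma layer_lt i z : layer xi i z -> xi i < z.
Proof. by case: i => [|i]; rewrite ?layer0 ?layerS// => /andP[]. Qed.

Lemma layer_gt0 i z : layer xi i z -> 0 < z.
Proof. by move=> /layer_lt; exact: lt_trans. Qed.

Lemma layer_gt i j z : layer xi j z -> (i < j)%N -> z < xi i.
Proof.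
case: j => // j; rewrite layerS ltnS => /andP[_ zj] ij.
by apply: lt_le_trans zj _; exact: Omega_le.
Qed.

Lemma layer_unique i j z : layer xi i z -> layer xi j z -> i = j.
Proof.
move=> iz jz; have [ij|ji|//] := ltngtP i j.
  by have := layer_gt _ _ _ jz ij; rewrite ltNge ltW// layer_lt.
by have := layer_gt _ _ _ iz ji; rewrite ltNge ltW// layer_lt.
Qed.

Lemma layer_xi i j : layer xi i (xi j) = false.
Proof.
apply/negP => ij; have := layer_lt _ _ ij; rewrite ltNge => /negP; apply.
have [ji|] := ltnP j i; first by have := layer_gt _ _ _ ij ji; rewrite ltxx.
exact: Omega_le.
Qed.

Lemma Omega_inj i j : xi i = xi j -> i = j.
Proof.
have lt m n : (m < n)%N -> xi n < xi m.
  by move=> mn; apply: le_lt_trans (Omega_lt _ Oxi m); exact: Omega_le.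
by move=> ij; have [/lt|/lt|//] := ltngtP i j; rewrite ij ltxx.
Qed.

(** As xi tends to 0, there is a least i with xi i < z. *)
Lemma layer_cover z : 0 < z -> (exists i, layer xi i z) \/ (exists j, z = xi j).
Proof.
move=> z0; have [i [iz min_i]] : exists i, xi i < z /\ forall j, (j < i)%N -> z <= xi j.
  have [n zn] : exists n, xi n < z.
    by have [N _ /(_ N (leqnn N))] := cvgr_lt _ xi_cvg0 _ z0; exists N.
  have ex : exists n, xi n < z by exists n.
  exists (ex_minn ex); case: ex_minnP => m mz min_m; split=> // j jm.
  by rewrite leNgt; apply/negP => /min_m; rewrite leqNgt jm.
case: i iz min_i => [|i] iz min_i; first by left; exists 0%N; rewrite layer0.
have := min_i i (ltnSn i); rewrite le_eqVlt => /predU1P[->|zi]; first by right; exists i.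
by left; exists i.+1; rewrite layerS iz.
Qed.

Lemma near_layer i z : layer xi i z -> \forall y \near z, layer xi i y.
Proof.
have near_lt (b c : R) : b < c -> \forall y \near c, b < y.
  by move=> bc; exact: (cvgr_gt _ (@cvg_id _ (nbhs c)) _ bc).
have near_gt (b c : R) : c < b -> \forall y \near c, y < b.
  by move=> bc; exact: (cvgr_lt _ (@cvg_id _ (nbhs c)) _ bc).
case: i => [|i]; first by rewrite layer0 => /near_lt; apply: filterS => y; rewrite layer0.
rewrite layerS => /andP[/near_lt + /near_gt].
by apply: filterS2 => y h1 h2; rewrite layerS h1.
Qed.

Lemma layer_right j :
  exists2 b, xi j < b & forall z, xi j < z -> z < b -> layer xi j z.
Proof.
case: j => [|j].
  by exists (xi 0%N + 1) => [|z jz _]; [rewrite ltrDl|rewrite layer0].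
by exists (xi j) => [|z jz zj]; [exact: Omega_lt|rewrite layerS jz].
Qed.

(** The requirements at different points are independent and, the layers and the
    points xi j being disjoint, compatible at each point. *)
Lemma profile_exists : exists U : R -> R, is_profile u a xi U.
Proof.
have /choice[U UP] : forall z : R, exists y : R,
    (forall i, layer xi i z -> y = phase_fun u a xi i z) /\
    (forall j, z = xi j -> y = u j.+1).
  move=> z; have [[i iz]|Nlayer] := pselect (exists i, layer xi i z).
    exists (phase_fun u a xi i z); split=> [j jz|j zj].
      by rewrite (layer_unique _ _ _ jz iz).
    by move: iz; rewrite zj layer_xi.
  have [[j zj]|Nxi] := pselect (exists j, z = xi j).
    exists (u j.+1); split=> [i iz|i zi]; first by case: Nlayer; exists i.
    by congr (u _.+1); apply: Omega_inj; rewrite -zj.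
  exists 0; split=> [i iz|j zj]; first by case: Nlayer; exists i.
  by case: Nxi; exists j.
exists U; split=> [i z iz|j]; first exact: (UP z).1.
exact: (UP (xi j)).2.
Qed.

Let gapN0 i : gap a xi i != 0.
Proof. by rewrite gt_eqF// gap_gt0. Qed.

(** The profile interpolates between u i and u i.+1, according to the fraction
    of the Gaussian mass of the layer which lies beyond z. *)
Lemma phase_funE i z : phase_fun u a xi i z =
  u i + (u i.+1 - u i) * ((Fdiv a xi i i - F (z / a i)%:E) / gap a xi i).
Proof.
rewrite /phase_fun -(opprB (Fdiv a xi i i)) -/(gap a xi i) invrN mulrN mulNr.
by rewrite -mulrN opprB mulrAC mulrA.
Qed.

Lemma phase_fun_cold i : phase_fun u a xi i (xi i) = u i.+1.
Proof.
rewrite phase_funE (_ : Fdiv a xi i i - F _ = gap a xi i)//.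
by rewrite divff// mulr1 addrC subrK.
Qed.

Lemma phase_fun_warm i : phase_fun u a xi i.+1 (xi i) = u i.+1.
Proof. by rewrite phase_funE /Fdiv/= subrr mul0r mulr0 addr0. Qed.

Lemma layer_fraction i z : layer xi i z ->
  0 < (Fdiv a xi i i - F (z / a i)%:E) / gap a xi i < 1.
Proof.
move=> iz; have z0 := layer_gt0 _ _ iz.
rewrite ltr_pdivrMr ?gap_gt0// mul1r /gap ltrD2l ltrN2.
have -> : Fdiv a xi i i.+1 < F (z / a i)%:E.
  rewrite /Fdiv/=; apply: F_lt; first by rewrite divr_ge0// ltW.
  by rewrite ltr_pM2r ?invr_gt0// layer_lt.
rewrite andbT divr_gt0 ?gap_gt0// subr_gt0; case: i iz => [|i] iz.
  by rewrite Fdiv0// F_lt1// divr_ge0// ltW.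
rewrite /Fdiv/= F_lt// ?divr_ge0 ?ltW// ltr_pM2r ?invr_gt0//.
by move: iz; rewrite layerS => /andP[].
Qed.

Lemma phase_fun_bounds i z : layer xi i z -> u i < u i.+1 ->
  u i < phase_fun u a xi i z < u i.+1.
Proof.
move=> /layer_fraction /andP[f0 f1] ui; rewrite phase_funE.
rewrite ltrDl mulr_gt0 ?subr_gt0//= -ltrBrDl.
by rewrite gtr_pMr ?subr_gt0.
Qed.

Lemma phase_fun_bounds_le i z : layer xi i z ->
  u i <= phase_fun u a xi i z <= u i.+1.
Proof.
move=> iz; have : u i <= u i.+1 by apply: u_ndecr.
rewrite le_eqVlt => /predU1P[uE|ui].
  by rewrite phase_funE -uE subrr mul0r addr0 lexx.
by have /andP[/ltW -> /ltW ->] := phase_fun_bounds _ _ iz ui.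
Qed.

Lemma continuous_phase_fun i z : 0 < z -> {for z, continuous (phase_fun u a xi i)}.
Proof.
move=> z0; have za0 : 0 < z / a i by rewrite divr_gt0.
have [dFz _] := is_derive_F _ za0.
have cFz : {for z / a i, continuous (fun y => F y%:E)}.
  exact/differentiable_continuous/derivable1_diffP.
have cz : y / a i @[y --> z] --> z / a i.
  by apply: cvgM; [exact: cvg_id|exact: cvg_cst].
apply: cvgD; first exact: cvg_cst.
apply: cvgM; first exact: cvg_cst.
by apply: cvgB; [exact: (cvg_comp _ _ cz cFz)|exact: cvg_cst].
Qed.

Context (U : R -> R) (UP : is_profile u a xi U).

Lemma profile_layer i z : layer xi i z -> U z = phase_fun u a xi i z.
Proof. by have [UL _] := UP; exact: UL. Qed.

Lemma profile_xi j : U (xi j) = u j.+1.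
Proof. by have [_] := UP. Qed.

Lemma near_profile_xi j : \forall z \near xi j,
  U z = phase_fun u a xi j z \/ U z = phase_fun u a xi j.+1 z.
Proof.
have [b jb bj] := layer_right j.
near=> z.
have jz : xi j.+1 < z.
  near: z; apply: (cvgr_gt _ (@cvg_id _ (nbhs (xi j)))); exact: Omega_lt.
have zb : z < b by near: z; exact: (cvgr_lt _ (@cvg_id _ (nbhs (xi j)))).
have [zj|zj|->] := ltgtP z (xi j).
- by right; apply: profile_layer; rewrite layerS jz.
- by left; apply: profile_layer; exact: bj.
- by left; rewrite profile_xi phase_fun_cold.
Unshelve. all: by end_near. Qed.

(** On each side of xi j the profile is given by one of the formulas of the two
    adjacent layers, and both are continuous with the same value at xi j. *)
Lemma continuous_profile z : 0 < z -> {for z, continuous U}.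
Proof.
move=> z0; have [[i iz]|[j ->]] := layer_cover _ z0.
  have := continuous_phase_fun i _ z0.
  rewrite /prop_for /continuous_at -(profile_layer _ _ iz).
  apply: cvg_trans; apply: near_eq_cvg.
  by apply: filterS (near_layer _ _ iz) => y /profile_layer.
have c1 := continuous_phase_fun j _ (xi0 j).
have c2 := continuous_phase_fun j.+1 _ (xi0 j).
rewrite /prop_for /continuous_at profile_xi.
move: c1 c2; rewrite /prop_for /continuous_at phase_fun_cold phase_fun_warm => c1 c2.
apply/cvgrPdist_le => e e0.
have /cvgrPdist_le /(_ e e0) h1 := c1; have /cvgrPdist_le /(_ e e0) h2 := c2.
near=> y; have : U y = phase_fun u a xi j y \/ U y = phase_fun u a xi j.+1 y.
  by near: y; exact: near_profile_xi.
by case=> ->; near: y.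
Unshelve. all: by end_near. Qed.

Lemma profile_bounds i z : layer xi i z -> u i <= U z <= u i.+1.
Proof. by move=> iz; rewrite (profile_layer _ _ iz) phase_fun_bounds_le. Qed.

(** The layers are recovered from the values of the profile, since u increases
    and the i-th layer is mapped between u i and u i.+1. *)
Lemma profile_phase i z : 0 < z -> u i < u i.+1 ->
  (u i < U z < u i.+1) = layer xi i z.
Proof.
move=> z0 ui; apply/idP/idP => [|iz]; last first.
  by rewrite (profile_layer _ _ iz) phase_fun_bounds.
move=> /andP[iU Ui]; have [[m mz]|[j zj]] := layer_cover _ z0.
  have /andP[mU Um] := profile_bounds _ _ mz.
  have [mi|im|<-//] := ltngtP m i.
    by have := lt_le_trans iU (le_trans Um (u_ndecr _ _ mi)); rewrite ltxx.
  by have := lt_le_trans Ui (le_trans (u_ndecr _ _ im) mU); rewrite ltxx.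
move: iU Ui; rewrite zj profile_xi => iU Ui.
have [ij|ji] := leqP i j.
  by have := lt_le_trans Ui (u_ndecr i.+1 j.+1 ij); rewrite ltxx.
by have := lt_le_trans iU (u_ndecr _ _ ji); rewrite ltxx.
Qed.

Lemma profile_cvgy : U z @[z --> +oo] --> u 0%N.
Proof.
have cF0 : phase_fun u a xi 0 z @[z --> +oo] --> u 0%N.
  rewrite -[X in _ --> X]addr0.
  apply: cvgD; first exact: cvg_cst.
  rewrite -[X in _ --> X](mulr0 ((u 1%N - u 0%N) / (Fdiv a xi 0 1 - Fdiv a xi 0 0))).
  apply: cvgM; first exact: cvg_cst.
  rewrite Fdiv0// -[X in _ --> X](subrr 1).
  apply: cvgB; last exact: cvg_cst.
  have cz : z / a 0%N @[z --> +oo] --> +oo.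
    by apply: gt0_cvgMly; [rewrite invr_gt0|exact: cvg_id].
  exact: (cvg_comp _ _ cz (@cvg_F R)).
apply: cvg_trans cF0; apply: near_eq_cvg; near=> z.
rewrite (profile_layer 0)// layer0.
by near: z; apply: nbhs_pinfty_gt; rewrite num_real.
Unshelve. all: by end_near. Qed.

Lemma profile_le_lim z : 0 < z -> ((U z)%:E <= limn (fun i => (u i)%:E))%E.
Proof.
move=> z0.
have u_lim i : ((u i)%:E <= limn (fun i => (u i)%:E))%E.
  have nd : nondecreasing_seq (fun i => (u i)%:E).
    by move=> m n mn; rewrite lee_fin u_ndecr.
  apply: lime_ge; first exact: ereal_nondecreasing_is_cvgn.
  by exists i => // j /= ij; rewrite lee_fin u_ndecr.
have [[i iz]|[j ->]] := layer_cover _ z0; last by rewrite profile_xi.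
apply: le_trans (u_lim i.+1); rewrite lee_fin.
by have /andP[] := profile_bounds _ _ iz.
Qed.

Lemma profile_ge i z : 0 < z -> z < xi i -> u i.+1 <= U z.
Proof.
move=> z0 zi; have [[m mz]|[j zj]] := layer_cover _ z0.
  have /andP[mU _] := profile_bounds _ _ mz.
  apply: le_trans mU; apply: u_ndecr; rewrite ltnNge; apply/negP => mi.
  have := lt_trans (layer_lt _ _ mz) zi.
  by rewrite ltNge Omega_le.
rewrite zj profile_xi u_ndecr// ltnS leqNgt; apply/negP => ji.
by move: zi; rewrite zj ltNge Omega_le// ltnW.
Qed.

(** By [profile_ge] the profile is at least u i near 0, for every i, and it never exceeds
    their limit; the limit may be +oo. *)
Lemma profile_cvg0 : (U z)%:E @[z --> 0^'+] --> limn (fun i => (u i)%:E).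
Proof.
set l := limn _.
have nd : nondecreasing_seq (fun i => (u i)%:E).
  by move=> m n mn; rewrite lee_fin u_ndecr.
have lE : l = ereal_sup (range (fun i => (u i)%:E)).
  by apply/cvg_lim => //; exact: ereal_nondecreasing_cvgn.
have above (c : R) : (c%:E < l)%E -> \forall z \near 0^'+, c < U z.
  rewrite lE => /ereal_sup_gt[_ [i _ <-]]; rewrite lte_fin => ci.
  near=> z; apply: lt_le_trans ci _.
  apply: le_trans (profile_ge i _ _ _); first exact: u_ndecr.
    by near: z; exact: nbhs_right_gt.
  by near: z; exact: nbhs_right_lt.
have below : \forall z \near 0^'+, ((U z)%:E <= l)%E.
  by near=> z; apply: profile_le_lim; near: z; exact: nbhs_right_gt.
have u0l : ((u 0%N)%:E <= l)%E.
  by rewrite lE; apply: ereal_sup_ubound; exists 0%N.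
move: above below u0l; case: l {lE} => [r| |] above below u0l.
- apply: cvg_EFin; first exact: nearW.
  apply/cvgrPdist_le => e e0.
  have := above (r - e); rewrite lte_fin gtrBl => /(_ e0) {}above.
  near=> z; have : r - e < U z by near: z.
  have : ((U z)%:E <= r%:E)%E by near: z.
  by rewrite lee_fin /= ler_norml; lra.
- apply/cvgeyPgt => M; have := above M (ltry M).
  by apply: filterS => z; rewrite lte_fin.
- by rewrite leeNy_eq in u0l.
Unshelve. all: by end_near. Qed.

End profile.

(** * Solution of the Stefan-Dirichlet problem *)

Section solution.
Context {R : realType} (u a k d : nat -> R).
Context (u01 : u 0%N <= u 1%N).
Context (u_incr : forall i : nat, (0 < i)%N -> u i < u i.+1).
Context (a_gt0 : forall i : nat, 0 < a i).
Context (xi : nat -> R) (Oxi : Omega xi) (xi_cvg0 : xi i @[i --> \oo] --> 0).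
Context (xi_stationary : forall j,
  d j.+1 * xi j / 2
  + k j * (u j.+1 - u j) * (dF (xi j / a j) / a j) / gap a xi j
  - k j.+1 * (u j.+2 - u j.+1) * (dF (xi j / a j.+1) / a j.+1) / gap a xi j.+1
  = 0).
Context (U : R -> R) (UP : is_profile u a xi U).

Let s (j : nat) (t : R) : R := xi j * Num.sqrt t.
Let v (t x : R) : R := U (x / Num.sqrt t).

Let xi0 := Omega_gt0 _ Oxi.

Definition phase_slope i : R := (u i.+1 - u i) / (Fdiv a xi i i.+1 - Fdiv a xi i i).

Definition phase_expr i : heat_expr R :=
  similarity_expr (u i - phase_slope i * Fdiv a xi i i) (phase_slope i).

Lemma phase_exprE i (t x : R) :
  phase_fun u a xi i (x / Num.sqrt t) = heval (a i) (phase_expr i) t x.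
Proof. by rewrite /phase_fun -/(phase_slope i) /=; ring. Qed.

Lemma stripP i (t x : R) : 0 < t ->
  strip s i (t, x) <-> 0 < x /\ layer xi i (x / Num.sqrt t).
Proof.
move=> t0; have st0 : 0 < Num.sqrt t by rewrite sqrtr_gt0.
suff -> : strip s i (t, x) = ((0 < t /\ 0 < x) /\ layer xi i (x / Num.sqrt t)) :> Prop.
  by split=> [[[_ ?] ?]|[? ?]].
rewrite /strip/=; congr (_ /\ is_true _).
case: i => [|i].
  by rewrite layer0 /= lte_fin ltry andbT ltr_pdivlMr.
by rewrite layerS /= !lte_fin ltr_pdivlMr// ltr_pdivrMr.
Qed.

Lemma solution_in_layer i (t x : R) : 0 < t -> layer xi i (x / Num.sqrt t) ->
  v t x = heval (a i) (phase_expr i) t x.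
Proof. by move=> t0 iz; rewrite -phase_exprE /v; exact: profile_layer. Qed.

Lemma near_layer_x i (t x : R) : 0 < t -> layer xi i (x / Num.sqrt t) ->
  \forall y \near x, layer xi i (y / Num.sqrt t).
Proof.
move=> t0 iz.
have cx : y / Num.sqrt t @[y --> x] --> x / Num.sqrt t.
  by apply: cvgM; [exact: cvg_id|exact: cvg_cst].
exact: (cx _ (near_layer xi _ _ iz)).
Qed.

Lemma near_layer_t i (t x : R) : 0 < t -> layer xi i (x / Num.sqrt t) ->
  \forall r \near t, layer xi i (x / Num.sqrt r).
Proof.
move=> t0 iz; have st0 : Num.sqrt t != 0 by rewrite gt_eqF// sqrtr_gt0.
have cx : x / Num.sqrt r @[r --> t] --> x / Num.sqrt t.
  apply: cvgM; first exact: cvg_cst.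
  by apply: cvgV => //; exact: sqrt_continuous.
exact: (cx _ (near_layer xi _ _ iz)).
Qed.

Lemma derive_x_strip i (t x : R) : 0 < t -> layer xi i (x / Num.sqrt t) ->
  is_derive x 1 (v t) (heval (a i) (hderiv_x (a i) (phase_expr i)) t x).
Proof.
move=> t0 iz; have st0 : 0 < Num.sqrt t by rewrite sqrtr_gt0.
have x0 : 0 < x.
  have := layer_gt0 _ Oxi _ _ iz.
  by rewrite pmulr_lgt0// invr_gt0.
apply: near_heval_x => //.
by apply: filterS (near_layer_x _ _ _ t0 iz) => y; exact: solution_in_layer.
Qed.

Lemma partial_x_strip i (t x : R) : 0 < t -> layer xi i (x / Num.sqrt t) ->
  partial_x v t x = heval (a i) (hderiv_x (a i) (phase_expr i)) t x.
Proof.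
move=> t0 iz; rewrite /partial_x derive1E.
by have [_ ->] := derive_x_strip _ _ _ t0 iz.
Qed.

Lemma heat_strip i (t x : R) : 0 < t -> 0 < x -> layer xi i (x / Num.sqrt t) ->
  partial_t v t x = a i ^+ 2 * partial_x (partial_x v) t x.
Proof.
move=> t0 x0 iz.
have -> : partial_t v t x = heval (a i) (hderiv_t (a i) (phase_expr i)) t x.
  rewrite /partial_t derive1E.
  suff [_ ->] : is_derive t 1 (v ^~ x)
    (heval (a i) (hderiv_t (a i) (phase_expr i)) t x) by [].
  apply: near_heval_t => //.
  near=> r; apply: solution_in_layer; first by near: r; exact: near_pos.
  by near: r; exact: near_layer_t.
have -> : partial_x (partial_x v) t x =
    heval (a i) (hderiv_x (a i) (hderiv_x (a i) (phase_expr i))) t x.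
  rewrite /partial_x derive1E -/(partial_x v).
  suff [_ ->] : is_derive x 1 (partial_x v t)
    (heval (a i) (hderiv_x (a i) (hderiv_x (a i) (phase_expr i))) t x) by [].
  apply: near_heval_x => //.
  by apply: filterS (near_layer_x _ _ _ t0 iz) => y; exact: partial_x_strip.
exact: similarity_heat.
Unshelve. all: by end_near. Qed.

(** Up to the factor - k_i, the heat flux of the phase-i formula. *)
Definition phase_flux (i : nat) (t x : R) : R :=
  phase_slope i * (dF (x / Num.sqrt t / a i) / (Num.sqrt t * a i)).

Lemma partial_x_cvg i (t x : R) : 0 < t -> 0 < x ->
  heval (a i) (hderiv_x (a i) (phase_expr i)) t y @[y --> x] --> phase_flux i t x.
Proof.
move=> t0 x0; have st0 : Num.sqrt t != 0 by rewrite gt_eqF// sqrtr_gt0.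
have -> : phase_flux i t x = heval (a i) (hderiv_x (a i) (phase_expr i)) t x.
  by rewrite /phase_flux /hderiv_x /= invfM; ring.
have [dx _] := is_derive_heval_x (a i) (a_gt0 i) (hderiv_x (a i) (phase_expr i)) t x t0 x0.
exact: (differentiable_continuous ((derivable1_diffP _ _).1 dx)).
Qed.

(** The stationarity condition of the j-th coordinate, divided by sqrt t. *)
Lemma stefan_condition j (t : R) : 0 < t ->
  d j.+1 * derive1 (s j) t + k j.+1 * phase_flux j.+1 t (s j t)
    - k j * phase_flux j t (s j t) = 0.
Proof.
move=> t0; have st0 : Num.sqrt t != 0 by rewrite gt_eqF// sqrtr_gt0.
have -> : derive1 (s j) t = xi j / (2 * Num.sqrt t).
  rewrite derive1E; have ds := is_derive1_sqrt t0.
  have [_ ->] : is_derive t 1 (s j) (xi j / (2 * Num.sqrt t)) by exact: (is_deriveZ (xi j) ds).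
  by [].
have slopeE i : phase_slope i = - ((u i.+1 - u i) / gap a xi i).
  by rewrite /phase_slope -(opprB (Fdiv a xi i i)) invrN mulrN.
rewrite /phase_flux /s mulfK// !slopeE.
have := congr1 ( *%R^~ (Num.sqrt t)^-1) (xi_stationary j).
rewrite mul0r => <-.
rewrite !invfM; ring.
Qed.

Lemma similarity_is_solution : stefan_dirichlet_solution u a k d s v.
Proof.
have sq0 (t : R) : 0 < t -> 0 < Num.sqrt t by rewrite sqrtr_gt0.
have z0 (t x : R) : quadrant (t, x) -> 0 < x / Num.sqrt t.
  by move=> [/= t0 x0]; rewrite divr_gt0// sq0.
have cover := layer_cover _ xi_cvg0.
split.
- move=> j t t0; rewrite /s mulr_gt0 ?sq0//= ltr_pM2r ?sq0//.
  exact: Omega_lt.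
- move=> j; apply: (@smooth_heval _ 1 ltr01
    (HMul (HConst (xi j)) (HMul HTime HInvSqrt))) => t x [/= t0 _].
  by rewrite /s -{2}(sqr_sqrtr (ltW t0)) expr2 mulfK// gt_eqF// sq0.
- move=> t x q; have [/= t0 x0] := q.
  have [[i iz]|[j zj]] := cover _ (z0 _ _ q).
    by left; exists i; apply/stripP.
  by right; exists j; rewrite /s -zj divfK// gt_eqF// sq0.
- move=> i ui; apply/seteqP; split=> [[t x] [q /= iv]|[t x] st].
    have [/= t0 x0] := q; apply/stripP => //; split=> //.
    by rewrite -(profile_phase u a u01 u_incr a_gt0 xi Oxi xi_cvg0 U UP)// z0.
  have [[/= t0 x0] _] := st; have [_ iz] := (stripP i t x t0).1 st.
  split=> //=.
  by rewrite (profile_phase u a u01 u_incr a_gt0 xi Oxi xi_cvg0 U UP)// z0.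
- move=> u0E t x st; have [[/= t0 x0] _] := st.
  have [_ iz] := (stripP 0 t x t0).1 st.
  by rewrite /v (profile_layer u a xi U UP _ _ iz) /phase_fun u0E subrr !mul0r addr0.
- by move=> j t t0; rewrite /v /s mulfK ?gt_eqF ?sq0// (profile_xi u a xi U UP).
- move=> [t x] q; have [/= t0 x0] := q.
  have cU := continuous_profile u a a_gt0 xi Oxi xi_cvg0 U UP _ (z0 _ _ q).
  exact: (cvg_comp _ _ (cvg_similarity t x t0) cU).
- move=> i; exists (heval (a i) (phase_expr i)).
    by apply: (@smooth_heval _ (a i) (a_gt0 i) (phase_expr i)).
  move=> t x st; have [[/= t0 x0] _] := st.
  by apply: solution_in_layer => //; have [] := (stripP i t x t0).1 st.
- move=> i t x [q /= iv]; have [/= t0 x0] := q.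
  apply: heat_strip => //.
  rewrite -(profile_phase u a u01 u_incr a_gt0 xi Oxi xi_cvg0 U UP)// ?z0//.
  by case/andP: iv; exact: lt_trans.
- move=> j t t0; have sj0 : 0 < s j t by rewrite /s mulr_gt0 ?sq0.
  exists (phase_flux j.+1 t (s j t)), (phase_flux j t (s j t)).
  split; last exact: stefan_condition.
  + have c := cvg_at_left_filter (partial_x_cvg j.+1 _ _ t0 sj0).
    apply: cvg_trans c; apply: near_eq_cvg; near=> y.
    rewrite (partial_x_strip j.+1)// layerS ltr_pdivlMr ?sq0// ltr_pdivrMr ?sq0//.
    apply/andP; split; near: y.
      by apply: nbhs_left_gt; rewrite /s ltr_pM2r ?sq0// Omega_lt.
    exact: nbhs_left_lt.
  + have [b jb bj] := layer_right xi Oxi j.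
    have c := cvg_at_right_filter (partial_x_cvg j _ _ t0 sj0).
    apply: cvg_trans c; apply: near_eq_cvg; near=> y.
    rewrite (partial_x_strip j)//.
    have jy : s j t < y by near: y; exact: nbhs_right_gt.
    apply: bj; first by rewrite ltr_pdivlMr ?sq0.
    rewrite ltr_pdivrMr ?sq0//; near: y; apply: nbhs_right_lt.
    by rewrite /s ltr_pM2r ?sq0.
- move=> x x0.
  have c : x / Num.sqrt t @[t --> 0^'+] --> +oo.
    apply/cvgryPgt => M; near=> t.
    have t0 : 0 < t by near: t; exact: nbhs_right_gt.
    have M0 : 0 < `|M| + 1 by rewrite ltr_wpDl.
    have : t < (x / (`|M| + 1)) ^+ 2.
      by near: t; apply: nbhs_right_lt; rewrite exprn_gt0// divr_gt0// ltr_wpDl.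
    rewrite -ltr_sqrt ?exprn_gt0 ?divr_gt0// sqrtr_sqr gtr0_norm ?divr_gt0//.
    rewrite ltr_pdivlMr// ltr_pdivlMr ?sq0// mulrC; apply: le_lt_trans.
    by rewrite ler_pM2r ?sq0//; have := ler_norm M; lra.
  exact: (cvg_comp _ _ c (profile_cvgy u a a_gt0 xi U UP)).
- move=> t t0.
  have c : x / Num.sqrt t @[x --> 0^'+] --> 0^'+.
    have c0 : x / Num.sqrt t @[x --> 0^'+] --> 0.
      rewrite -[X in _ --> X](mul0r (Num.sqrt t)^-1); apply: cvg_at_right_filter.
      by apply: cvgM; [exact: cvg_id|exact: cvg_cst].
    move=> A /c0; apply: filterS2 (nbhs_right_gt 0) => x x0; apply.
    by rewrite divr_gt0 ?sq0.
  exact: (cvg_comp _ _ c (profile_cvg0 u a u01 u_incr a_gt0 xi Oxi xi_cvg0 U UP)).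
Unshelve. all: by end_near. Qed.

End solution.

Theorem theorem2p1 (R : realType) (u a k d : nat -> R)
  (u01 : u 0%N <= u 1%N)
  (u_incr : forall i : nat, (0 < i)%N -> u i < u i.+1)
  (a_gt0 : forall i : nat, 0 < a i)
  (k_gt0 : forall i : nat, 0 < k i)
  (d_ge0 : forall i : nat, (0 < i)%N -> 0 <= d i)
  (d1_gt0 : u 1%N = u 0%N -> 0 < d 1%N)
  (E_proper : (ereal_inf (E u a k d @` Omega) < +oo)%E) :
  (exists! xi : nat -> R,
     Omega xi /\ E u a k d xi = ereal_inf (E u a k d @` Omega)) /\
  (forall xi : nat -> R,
     Omega xi -> E u a k d xi = ereal_inf (E u a k d @` Omega) ->
     [/\ xi i @[i --> \oo] --> 0,
         exists U : R -> R, is_profile u a xi U &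
         forall U : R -> R, is_profile u a xi U ->
           stefan_dirichlet_solution u a k d
             (fun j t => xi j * Num.sqrt t)
             (fun t x => U (x / Num.sqrt t))]).
Proof.
split=> [|xi Oxi Exi].
  have [xi mxi] := minimizer_exists u a k d u01 u_incr a_gt0 k_gt0 d_ge0 d1_gt0
    E_proper.
  exists xi; split=> // eta meta.
  exact: (minimizer_unique u a k d u01 u_incr a_gt0 k_gt0 d_ge0 E_proper).
have mxi : minimizer u a k d xi by [].
have xi_cvg0 := minimizer_cvg0 u a k d u01 u_incr a_gt0 k_gt0 d_ge0 E_proper
  xi mxi.
split=> // [|U UP]; first exact: profile_exists.
apply: similarity_is_solution => // j.
exact: (minimizer_stationary u a k d u01 u_incr a_gt0 k_gt0 d_ge0 E_proper).
Qed.
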